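(* Let $\alpha=(\alpha^m)_{m\in\mathbb N}$ be any normal DPSF whose values are polynomially bounded in the number of alternatives (i.e., $\alpha^m(1)\le p(m)$ for some polynomial $p$), and let $r$ be any constant with $0<r\le1$. Unless $\mathrm{P}=\mathrm{NP}$, there is no polynomial-time algorithm that, on every instance of $\alpha$-SE-Monroe, returns a feasible Monroe $K$-assignment $\Phi$ with $\ell_{\min}^\alpha(\Phi)\ge r\cdot\mathrm{OPT}$, where $\mathrm{OPT}$ is the maximum of $\ell_{\min}^\alpha$ over all feasible Monroe $K$-assignments.
   Context: Agents $N=[n]$, alternatives $A=\{a_1,\dots,a_m\}$. Each agent $i$ has a strict linear order $\succ_i$ on $A$; $\mathrm{pos}_i(a)\in[m]$ is the position of $a$ in $\succ_i$ ($1$ = most preferred). A normal DPSF is a family $\alpha=(\alpha^m)_{m\in\mathbb N}$ of functions $\alpha^m:[m]\to\mathbb N$ such that each $\alpha^m$ is strictly decreasing, $\alpha^m(m)=0$, $\alpha^{m+1}(i+1)=\alpha^m(i)$ for all $i\in[m]$, and $\alpha^m$ is computable in time polynomial in $m$ ($\alpha^m(i)$ is the satisfaction of an agent assigned to her $i$-th ranked alternative, $m$ being the number of alternatives). Given capacities, a $K$-assignment is a function $\Phi:N\to A$ with $|\Phi(N)|\le K$ and $|\Phi^{-1}(a)|\le\mathrm{cap}_a$ for all $a$. $\ell_{\min}^\alpha(\Phi)=\min_{i\in N}\alpha^m(\mathrm{pos}_i(\Phi(i)))$. An instance of $\alpha$-SE-Monroe consists of $N$, $A$, the profile, and a positive integer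 $K$ dividing $n$; each alternative has capacity $n/K$; the goal is a $K$-assignment maximizing $\ell_{\min}^\alpha$. *)

(* Defs.v *)
From mathcomp Require Import all_boot all_order all_algebra all_fingroup.
From mathcomp Require Import reals.
Unset Printing Implicit Defensive.

(* A machine model: deterministic single-tape Turing machines over the  *)
(* tape alphabet {0,1,blank} (blank = None), two-way infinite tape.     *)

Inductive move := MoveL | MoveR | Stay.

Record TM := {
  tm_state : finType;
  tm_start : tm_state;
  tm_halt  : pred tm_state;
  tm_delta : tm_state -> option bool -> tm_state * option bool * move
}.

(* configuration: state, (left part reversed, head symbol, right part) *)
Definition tape := (seq (option bool) * option bool * seq (option bool))%type.
Definition config (M : TM) := (tm_state M * tape)%type.

Definition tm_step (M : TM) (c : config M) : config M :=
  let: (q, (l, h, r)) := c in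
  if tm_halt M q then c else
  let: (q', w, mv) := tm_delta M q h in
  match mv with
  | Stay => (q', (l, w, r))
  | MoveL => match l with
             | [::] => (q', ([::], None, w :: r))
             | a :: l' => (q', (l', a, w :: r))
             end
  | MoveR => match r with
             | [::] => (q', (w :: l, None, [::]))
             | a :: r' => (q', (w :: l, a, r'))
             end
  end.

Definition tm_init (M : TM) (x : seq bool) : config M :=
  match x with
  | [::] => (tm_start M, ([::], None, [::]))
  | b :: x' => (tm_start M, ([::], Some b, map Some x'))
  end.

Fixpoint read_out (s : seq (option bool)) : seq bool :=
  match s with
  | Some b :: s' => b :: read_out s'
  | _ => [::]
  end.

Definition tm_output (M : TM) (c : config M) : seq bool :=
  let: (_, (_, h, r)) := c in read_out (h :: r).

Definition runs (M : TM) (x : seq bool) (t : nat) (y : seq bool) : Prop :=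
  let c := iter t (tm_step M) (tm_init M x) in
  tm_halt M c.1 /\ tm_output M c = y.

Definition poly_bound (c k s : nat) : nat := c * s ^ k + c.

Definition inP (L : seq bool -> Prop) : Prop :=
  exists (M : TM) (c k : nat), forall x : seq bool,
    exists (t : nat) (b : bool), [/\ t <= poly_bound c k (size x),
      runs M x t [:: b] & (b = true <-> L x)].

Definition pair_enc (x y : seq bool) : seq bool :=
  flatten [seq [:: b; b] | b <- x] ++ [:: false; true] ++ y.

Definition inNP (L : seq bool -> Prop) : Prop :=
  exists V : seq bool -> Prop, inP V /\
  exists c k : nat, forall x : seq bool,
    L x <-> exists y : seq bool, size y <= poly_bound c k (size x) /\ V (pair_enc x y).

Definition P_eq_NP : Prop := forall L, inNP L -> inP L.

Definition enc_nat (k : nat) : seq bool := nseq k true ++ [:: false].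

(* sigma i is agent i's ranking: sigma i j is the alternative at position j+1 *)
Definition enc_instance (n m K : nat) (sigma : 'I_n -> {perm 'I_m}) : seq bool :=
  enc_nat n ++ enc_nat m ++ enc_nat K ++
  flatten [seq flatten [seq enc_nat (sigma i j) | j <- enum 'I_m] | i <- enum 'I_n].

Definition enc_assignment (n m : nat) (Phi : 'I_n -> 'I_m) : seq bool :=
  flatten [seq enc_nat (Phi i) | i <- enum 'I_n].

(* alpha m i = alpha^m(i), meaningful for 1 <= i <= m.                  *)

Definition normal_DPSF (alpha : nat -> nat -> nat) : Prop :=
  [/\ (forall m i j, 1 <= i -> i < j -> j <= m -> alpha m j < alpha m i),
      (forall m, 1 <= m -> alpha m m = 0),
      (forall m i, 1 <= i <= m -> alpha m.+1 i.+1 = alpha m i) &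
      (exists (M : TM) (c k : nat), forall m i, 1 <= i <= m ->
          exists t, t <= poly_bound c k m /\
            runs M (enc_nat m ++ enc_nat i) t (nseq (alpha m i) true))].

Definition poly_bounded_DPSF (alpha : nat -> nat -> nat) : Prop :=
  exists c k : nat, forall m, 1 <= m -> alpha m 1 <= poly_bound c k m.

(* position (1 = most preferred) of alternative a for agent i *)
Definition pos (n m : nat) (sigma : 'I_n -> {perm 'I_m}) (i : 'I_n) (a : 'I_m) : nat :=
  (((sigma i)^-1)%g a).+1.

Definition monroe_feasible (n m K : nat) (Phi : 'I_n -> 'I_m) : Prop :=
  #|[set Phi i | i : 'I_n]| <= K /\
  forall a : 'I_m, #|[set i : 'I_n | Phi i == a]| <= n %/ K.

(* l_min^alpha(Phi) = min_i alpha^m(pos_i(Phi i)); the neutral element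
   alpha^m(1) is an upper bound of all values (alpha^m decreasing) and
   the instances considered have n > 0. *)
Definition lmin (alpha : nat -> nat -> nat) (n m : nat)
    (sigma : 'I_n -> {perm 'I_m}) (Phi : 'I_n -> 'I_m) : nat :=
  \big[minn/alpha m 1]_(i < n) alpha m (pos n m sigma i (Phi i)).

(* valid SE-Monroe instance: K positive, K divides n (n > 0), and a
   feasible K-assignment exists (so that OPT is defined) *)
Definition valid_instance (n m K : nat) : Prop :=
  [/\ 0 < n, 0 < K, K %| n & exists Phi : 'I_n -> 'I_m, monroe_feasible n m K Phi].

Definition approx_algorithm (alpha : nat -> nat -> nat) (R : realType) (r : R)
    (M : TM) : Prop :=
  exists c k : nat, forall (n m K : nat) (sigma : 'I_n -> {perm 'I_m}),
    valid_instance n m K ->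
    exists (t : nat) (Phi : 'I_n -> 'I_m),
      [/\ (t <= poly_bound c k (size (enc_instance n m K sigma)))%N,
          runs M (enc_instance n m K sigma) t (enc_assignment n m Phi),
          monroe_feasible n m K Phi &
          forall Psi : 'I_n -> 'I_m, monroe_feasible n m K Psi ->
            (r * (lmin alpha n m sigma Psi)%:R <= (lmin alpha n m sigma Phi)%:R)%R ].

(* Main.v *)
(* An approximation algorithm decides every language of NP. Choose a verifying
   Turing machine and a word [x]. That some short certificate of [x] is accepted
   means that a tableau can be filled in so that a local rule holds, i.e. that a
   system of constraints "colour of [v] = colour of its left (lower) neighbour"
   is solvable, each variable having finitely many values.
     Such a system becomes a Monroe instance in the manner of exact cover. There is
   an alternative for every value of every variable, and agents (slots) for every
   variable and every pair of a neighbour and a colour; the value [d] of [v] is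
   liked by the slots of [v] with the colour of [d] and by the slots of the next
   variable with another colour than that of [d], so that exactly [cap] agents
   like the values used by a solution. Moreover there are [mp] dummy alternatives
   with [cap] agents each, who rank all other alternatives last. If [K] is the
   number of variables plus [mp], and nobody gets an alternative ranked below the
   dummies, then all dummies are used up by their own agents, which leaves one
   value for every variable. Dummies are ranked above the alternatives disliked, so
   that the optimum is at least [mp] if the constraints are solvable, while a
   disliked alternative is worth at most [alpha^m1(1)] to an agent, where [m1], the
   number of other alternatives, does not depend on [mp]. As this is polynomial in
   [m1], a polynomial [mp] makes the gap larger than [1 / r].
     Polynomial-time computations are composed at the level of functions on lists of
   strings (the predicate [FP]), closed under composition and under recursion on
   notation with polynomially bounded results; these functions are computed by a
   register language, hence by single-tape Turing machines. *)
From HB Require Import structures.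
Require Import Defs.
From mathcomp Require Import all_boot all_order all_algebra all_fingroup.
From mathcomp Require Import reals zify.
From Stdlib Require Import FunctionalExtensionality.
Set Implicit Arguments.
Unset Strict Implicit.
Unset Printing Implicit Defensive.


(** * Polynomial bounds *)

Definition pb (c k n : nat) : nat := c * n.+1 ^ k.

Lemma pb_mono c k m n : m <= n -> pb c k m <= pb c k n.
Proof.
move=> le_mn; rewrite /pb leq_mul2l; case: k => [|k]; first by rewrite leqnn orbT.
by rewrite leq_exp2r // ltnS le_mn orbT.
Qed.

Definition polybd (p : nat -> nat) := exists c k, forall n, p n <= pb c k n.

Lemma polybd_pb c k : polybd (pb c k).
Proof. by exists c, k. Qed.

Lemma polybd_id : polybd id.
Proof. by exists 1, 1 => n; rewrite /pb; lia. Qed.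

Lemma polybd_cst a : polybd (fun=> a).
Proof. by exists a, 0 => n; rewrite /pb; lia. Qed.

Lemma polybd_mul p q : polybd p -> polybd q -> polybd (fun n => p n * q n).
Proof.
move=> [c [k pP]] [d [l qP]]; exists (c * d), (k + l) => n.
by rewrite /pb expnD mulnACA leq_mul ?pP ?qP.
Qed.

Lemma polybd_add p q : polybd p -> polybd q -> polybd (fun n => p n + q n).
Proof.
move=> [c [k pP]] [d [l qP]]; exists (c + d), (k + l) => n.
rewrite /pb mulnDl leq_add //.
  by apply: leq_trans (pP n) _; rewrite leq_mul2l leq_pexp2l ?leq_addr ?orbT.
by apply: leq_trans (qP n) _; rewrite leq_mul2l leq_pexp2l ?leq_addl ?orbT.
Qed.

(** The monotone bound of [p] takes the place of [p] before [q] is substituted, and [q n + 1] is at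
    most [(d + 1) (n + 1)^l]. *)
Lemma polybd_comp p q : polybd p -> polybd q -> polybd (fun n => p (q n)).
Proof.
move=> [c [k pP]] [d [l qP]]; exists (c * d.+1 ^ k), (l * k) => n.
apply: leq_trans (pP _) _; rewrite /pb -mulnA leq_mul2l expnM -expnMn.
have -> : (q n).+1 ^ k <= (d.+1 * n.+1 ^ l) ^ k; last by rewrite orbT.
case: k {pP} => // k; rewrite leq_exp2r //.
have := qP n; rewrite /pb mulSn => h.
by rewrite -add1n leq_add // expn_gt0.
Qed.

Lemma polybd_pbc c k q : polybd q -> polybd (fun n => pb c k (q n)).
Proof. exact: polybd_comp (polybd_pb c k). Qed.

Ltac polybd := repeat first [ apply: polybd_cst | apply: polybd_id | apply: polybd_pb
  | apply: polybd_pbc | apply: polybd_add | apply: polybd_mul ].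

(** [n + 1 <= 2 n] for positive [n] accounts for the factor [2 ^ k]; for [n = 0] the additive
    constant of [poly_bound] suffices. *)
Lemma pb_poly_bound c k n : pb c k n <= poly_bound (c * 2 ^ k) k n.
Proof.
rewrite /poly_bound /pb; case: n => [|n].
  by rewrite exp1n muln1 (leq_trans _ (leq_addl _ _)) // leq_pmulr // expn_gt0.
rewrite (leq_trans _ (leq_addr _ _)) // -mulnA leq_mul2l -expnMn.
by case: k => [|k]; rewrite ?expn0 ?leqnn ?orbT // leq_exp2r // orbC; lia.
Qed.

Lemma poly_bound_mono c k m n : m <= n -> poly_bound c k m <= poly_bound c k n.
Proof.
move=> le_mn; rewrite /poly_bound leq_add2r leq_mul2l.
by case: k => [|k]; rewrite ?expn0 ?leqnn ?orbT // leq_exp2r // le_mn orbT.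
Qed.

(** * A register language over bit strings *)

Notation str := (seq bool).
Definition state := nat -> str.
Definition upd (s : state) j v : state := fun i => if i == j then v else s i.

(* [Loop j cF cT] pops register [j] until it is empty, running [cF] or [cT]
   according to the bit popped. *)
Inductive cmd :=
  | Skip
  | Push of nat & bool
  | Seq of cmd & cmd
  | Loop of nat & cmd & cmd.

(* The last argument is any upper bound on the number of steps, so that [exec]
   is monotone in it. *)
Inductive exec : cmd -> state -> state -> nat -> Prop :=
  | exec_skip s t : exec Skip s s t
  | exec_push j b s t : 0 < t -> exec (Push j b) s (upd s j (b :: s j)) t
  | exec_seq c1 c2 s1 s2 s3 t1 t2 t :
      exec c1 s1 s2 t1 -> exec c2 s2 s3 t2 -> t1 + t2 < t ->
      exec (Seq c1 c2) s1 s3 t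
  | exec_loop_nil j cF cT s t : s j = [::] -> 0 < t -> exec (Loop j cF cT) s s t
  | exec_loop_cons j cF cT b w s s1 s2 t1 t2 t :
      s j = b :: w -> exec (if b then cT else cF) (upd s j w) s1 t1 ->
      exec (Loop j cF cT) s1 s2 t2 -> t1 + t2 + 2 <= t ->
      exec (Loop j cF cT) s s2 t.

Lemma exec_mono c s s' t t' : exec c s s' t -> t <= t' -> exec c s s' t'.
Proof.
case=> {c s s' t}.
- by move=> *; apply: exec_skip.
- by move=> j b s t t0 tt'; apply: exec_push; lia.
- by move=> c1 c2 s1 s2 s3 t1 t2 t e1 e2 lt le; apply: exec_seq e1 e2 _; lia.
- by move=> j cF cT s t sj t0 tt'; apply: exec_loop_nil => //; lia.
- move=> j cF cT b w s s1 s2 t1 t2 t sj e1 e2 lt le.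
  by apply: exec_loop_cons sj e1 e2 _; lia.
Qed.

Lemma exec_eq c s s1 s2 t t' :
  exec c s s1 t -> (forall i, s1 i = s2 i) -> t <= t' -> exec c s s2 t'.
Proof. by move=> e /functional_extensionality <-; apply: exec_mono. Qed.

(** A step lengthens a register by at most one bit, so that time bounds also bound the size of
    results. *)
Lemma exec_size c s s' t i : exec c s s' t -> size (s' i) <= size (s i) + t.
Proof.
elim=> {c s s' t}; rewrite ?/upd.
- by move=> *; lia.
- by move=> j b s t t0; case: eqP => [->|_] /=; lia.
- by move=> c1 c2 s1 s2 s3 t1 t2 t _ i1 _ i2 lt; lia.
- by move=> *; lia.
- move=> j cF cT b w s s1 s2 t1 t2 t sj _ + _ i2 lt.
  by case: eqP => [eij|_] i1; [rewrite {2}eij sj /=|]; lia.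
Qed.

Lemma upd_same s j v : upd s j v j = v.
Proof. by rewrite /upd eqxx. Qed.

Lemma upd_other s i j v : i <> j -> upd s j v i = s i.
Proof. by rewrite /upd; case: eqP. Qed.

Ltac upd_tac := rewrite /upd /=; repeat (case: eqP => ? /=); subst;
  rewrite ?eqxx ?cats0 //; try lia; try congruence.

Definition clear j := Loop j Skip Skip.
(** Moving bit by bit reverses a string, hence two moves restore it; [revmove2] writes two copies,
    one of which can replace the string consumed. *)
Definition revmove j i := Loop j (Push i false) (Push i true).
Definition revmove2 j i1 i2 :=
  Loop j (Seq (Push i1 false) (Push i2 false)) (Seq (Push i1 true) (Push i2 true)).

Lemma exec_clear j s : exec (clear j) s (upd s j [::]) (2 * size (s j) + 1).
Proof.
move sj : (s j) => w; elim: w s sj => [|b w IH] s sj.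
  apply: exec_eq (exec_loop_nil _ _ sj (ltnSn 0)) _ _ => // i; upd_tac.
have h : upd s j w j = w by upd_tac.
apply: (@exec_loop_cons _ _ _ _ _ _ _ _ 0 (2 * size w + 1) _ sj); last 1 first.
- by rewrite /=; lia.
- by case: b {sj}; apply: exec_skip.
by apply: exec_eq (IH _ h) _ _ => [i|] /=; [upd_tac|lia].
Qed.

Lemma exec_revmove j i s : i <> j ->
  exec (revmove j i) s (upd (upd s i (catrev (s j) (s i))) j [::]) (3 * size (s j) + 1).
Proof.
move=> ij; move sj : (s j) => w; elim: w s sj => [|b w IH] s sj.
  apply: exec_eq (exec_loop_nil _ _ sj (ltnSn 0)) _ _ => // i'; upd_tac.
have h : upd (upd s j w) i (b :: s i) j = w by upd_tac.
apply: (@exec_loop_cons _ _ _ _ _ _ _ _ 1 (3 * size w + 1) _ sj); last 1 first.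
- by rewrite /=; lia.
- have -> : (if b then Push i true else Push i false) = Push i b by case: (b).
  exact: exec_push.
apply: exec_eq (IH _ _) _ _ => [|i'|] /=; [by upd_tac..|lia].
Qed.

Lemma exec_revmove2 j i1 i2 s : i1 <> j -> i2 <> j -> i1 <> i2 ->
  exec (revmove2 j i1 i2) s
    (upd (upd (upd s i1 (catrev (s j) (s i1))) i2 (catrev (s j) (s i2))) j [::])
    (5 * size (s j) + 1).
Proof.
move=> i1j i2j i12; move sj : (s j) => w; elim: w s sj => [|b w IH] s sj.
  apply: exec_eq (exec_loop_nil _ _ sj (ltnSn 0)) _ _ => // i'; upd_tac.
have h : upd (upd (upd s j w) i1 (b :: s i1)) i2 (b :: s i2) j = w by upd_tac.
apply: (@exec_loop_cons _ _ _ _ _ _ _ _ 3 (5 * size w + 1) _ sj); last 1 first.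
- by rewrite /=; lia.
- have -> : (if b then Seq (Push i1 true) (Push i2 true)
             else Seq (Push i1 false) (Push i2 false))
             = Seq (Push i1 b) (Push i2 b) by case: (b).
  by apply: exec_seq (exec_push _ _ _ (ltnSn 0)) (exec_push _ _ _ (ltnSn 0)) _.
apply: exec_eq (IH _ _) _ _ => [|i'|] /=; [by upd_tac..|lia].
Qed.

(** Loop rule: [I w] is the state in which [w] is left in register [j], and [B] bounds one run of
    the body. *)
Lemma exec_loop j cF cT (I : str -> state) B w :
  (forall w', I w' j = w') ->
  (forall v b w', w = v ++ b :: w' ->
     exec (if b then cT else cF) (upd (I (b :: w')) j w') (I w') B) ->
  exec (Loop j cF cT) (I w) (I [::]) ((B + 2) * size w + 1).
Proof.
move=> Ij; elim: w => [|b w IH] body; first by apply: exec_loop_nil => //; lia.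
apply: (exec_loop_cons (Ij _) (body [::] _ _ erefl) (IH _)) => [v b' w' vw|].
  by apply: (body (b :: v)); rewrite vw.
by rewrite /=; lia.
Qed.

(** * Polynomial-time functions of a list of strings *)

Definition esize (e : seq str) := sumn (map size e).

Definition computes (comp : seq nat -> nat -> nat -> cmd) (f : seq str -> str)
    (p : nat -> nat) := forall args dst fr s,
  all (fun a => a < fr) args -> dst < fr -> dst \notin args -> s dst = [::] ->
  (forall j, fr <= j -> s j = [::]) ->
  exec (comp args dst fr) s (upd s dst (f (map s args))) (p (esize (map s args))).

(* [comp args dst fr] reads its arguments in the registers [args] without
   altering them, writes the result to [dst] and uses the registers from [fr]
   on, initially and finally empty, as scratch space. *)
Definition FP (f : seq str -> str) := exists comp c k, computes comp f (pb c k).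

Lemma FP_intro comp f p : polybd p -> computes comp f p -> FP f.
Proof.
move=> [c [k pP]] cf; exists comp, c, k => args dst fr s h1 h2 h3 h4 h5.
exact: exec_mono (cf _ _ _ _ h1 h2 h3 h4 h5) (pP _).
Qed.

Lemma FP_ext f g : FP f -> (forall e, f e = g e) -> FP g.
Proof. by move=> Ff /functional_extensionality <-. Qed.

Lemma map_upd_lt s j v args : all (fun a => a < j) args ->
  map (upd s j v) args = map s args.
Proof.
by move=> lt; apply/eq_in_map => a /(allP lt); rewrite /upd; case: eqP => // ->; rewrite ltnn.
Qed.

Lemma map_upd_notin s j v args : j \notin args -> map (upd s j v) args = map s args.
Proof.
by move=> nj; apply/eq_in_map => a; rewrite /upd; case: eqP => // ->; rewrite (negPf nj).
Qed.

Lemma computes_size comp f p args dst fr s : computes comp f p ->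
  all (fun a => a < fr) args -> dst < fr -> dst \notin args -> s dst = [::] ->
  (forall j, fr <= j -> s j = [::]) ->
  size (f (map s args)) <= p (esize (map s args)).
Proof.
move=> cf h1 h2 h3 h4 h5.
by have := exec_size dst (cf _ _ _ _ h1 h2 h3 h4 h5); rewrite /upd eqxx h4.
Qed.

(** A program cannot write more than its running time allows. To apply this to [e], its strings are
    put into the registers from 0 on, and the next register receives the result. *)
Lemma FP_size f : FP f -> exists c k, forall e, size (f e) <= pb c k (esize e).
Proof.
move=> [comp [c [k cf]]]; exists c, k => e.
have he : map (nth [::] e) (iota 0 (size e)) = e by rewrite map_nth_iota0 ?take_size.
rewrite -[in f e]he -[in esize e]he.
apply: (computes_size (dst := size e) (fr := (size e).+1) cf).
- by apply/allP => a; rewrite mem_iota; lia.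
- exact: ltnSn.
- by rewrite mem_iota; lia.
- by rewrite nth_default.
- by move=> j lj; rewrite nth_default // ltnW.
Qed.

Lemma FP_nil : FP (fun=> [::]).
Proof.
apply: (@FP_intro (fun _ _ _ => Skip) _ (fun=> 0)); first exact: polybd_cst.
move=> args dst fr s h1 h2 h3 h4 h5.
by apply: exec_eq (exec_skip _ 0) _ _ => // i; upd_tac.
Qed.

Lemma FP_cons b f : FP f -> FP (fun e => b :: f e).
Proof.
move=> [cf [c [k Hf]]].
apply: (@FP_intro (fun args dst fr => Seq (cf args dst fr) (Push dst b)) _
  (fun n => pb c k n + 2)); first by polybd.
move=> args dst fr s h1 h2 h3 h4 h5.
have e1 := Hf _ _ _ _ h1 h2 h3 h4 h5.
have e2 := exec_seq e1 (exec_push dst b _ (ltnSn 0)) (leqnn _).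
by apply: exec_eq e2 _ _ => [i|]; [upd_tac|lia].
Qed.

Lemma FP_cst w : FP (fun=> w).
Proof. by elim: w => [|b w IH]; [exact: FP_nil|exact: FP_cons]. Qed.

Lemma esize_nth e i : size (nth [::] e i) <= esize e.
Proof. by elim: e i => [|x e IH] [|i] //=; [exact: leq_addr|exact: leq_trans (IH _) (leq_addl _ _)]. Qed.

Lemma FP_nth i : FP (fun e => nth [::] e i).
Proof.
apply: (@FP_intro (fun args dst fr => if i < size args then
    Seq (revmove (nth 0 args i) fr) (revmove2 fr (nth 0 args i) dst) else Skip) _
  (fun n => 8 * n + 10)); first by polybd.
move=> args dst fr s h1 h2 h3 h4 h5.
case: ltnP => lt; last first.
  by apply: exec_eq (exec_skip _ 0) _ _ => // j; rewrite nth_default ?size_map //; upd_tac.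
have h6 : nth 0 args i < fr by apply: (allP h1); apply: mem_nth.
have h7 : nth 0 args i <> dst by move=> h; rewrite -h mem_nth in h3.
have := esize_nth (map s args) i.
rewrite (nth_map 0) //; set a := nth 0 args i in h6 h7 * => sz.
have n1 : fr <> a by lia.
have e1 := exec_revmove s n1; set s1 := upd (upd _ _ _) _ _ in e1.
have s1f : s1 fr = rev (s a).
  by rewrite /s1 upd_other // upd_same (h5 fr) // catrevE cats0.
have s1a : s1 a = [::] by rewrite /s1 /upd eqxx.
have s1d : s1 dst = [::] by rewrite /s1; upd_tac.
have n2 : a <> fr by lia.
have n3 : dst <> fr by lia.
have e2 := exec_seq e1 (exec_revmove2 s1 n2 n3 h7) (ltnSn _).
apply: exec_eq e2 _ _ => [j|].
  rewrite s1f s1a s1d !catrevE !cats0 revK /s1.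
  by upd_tac; rewrite ?h5 //; congruence.
by rewrite s1f size_rev; lia.
Qed.

(** The same program is given a shorter list of registers. Since [i <= j], no argument is duplicated
    and the total size does not grow. *)
Lemma FP_take_drop i j f : i <= j -> FP f -> FP (fun e => f (take i e ++ drop j e)).
Proof.
move=> ij [cf [c [d Hf]]]; exists (fun args => cf (take i args ++ drop j args)), c, d.
move=> args dst fr s h1 h2 h3 h4 h5.
have sub : {subset take i args ++ drop j args <= args}.
  by move=> a; rewrite mem_cat => /orP[/mem_take|/mem_drop].
have h := Hf (take i args ++ drop j args) dst fr s _ h2 _ h4 h5.
rewrite -map_take -map_drop -map_cat; apply: exec_mono (h _ _) _.
- by apply/allP => a /sub; apply: (allP h1).
- by apply: contra h3; apply: sub.
apply: pb_mono; rewrite /esize -[in X in _ <= X](cat_take_drop i (map s args)).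
rewrite map_cat map_take map_drop !map_cat !sumn_cat leq_add2l -(subnK ij) -drop_drop.
rewrite -[in X in _ <= X](cat_take_drop (j - i) (drop i (map s args))).
by rewrite map_cat sumn_cat leq_addl.
Qed.

Lemma FP_behead f : FP f -> FP (fun e => f (behead e)).
Proof. by move=> /(@FP_take_drop 0 1 _ isT) /FP_ext; apply => e; rewrite take0 drop1. Qed.

(** The intermediate result lives in the scratch register [fr], which is one more argument of the
    second program and is emptied at the end. *)
Lemma FP_let g f : FP g -> FP f -> FP (fun e => f (g e :: e)).
Proof.
move=> [cg [c1 [k1 Hg]]] [cf [c2 [k2 Hf]]].
apply: (@FP_intro (fun args dst fr => Seq (cg args fr fr.+1)
    (Seq (cf (fr :: args) dst fr.+1) (clear fr))) _
  (fun n => pb c1 k1 n + pb c2 k2 (pb c1 k1 n + n) + 2 * pb c1 k1 n + 5)).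
  by polybd.
move=> args dst fr s h1 h2 h3 h4 h5.
have l1 : all (fun a => a < fr.+1) args by apply: sub_all h1 => a; lia.
have nfr : fr \notin args by apply/negP => /(allP h1); rewrite ltnn.
have sfr : s fr = [::] by apply: h5.
have sS j : fr.+1 <= j -> s j = [::] by move=> lj; apply: h5; lia.
have e1 := Hg args fr fr.+1 s l1 (ltnSn _) nfr sfr sS.
have z1 := computes_size Hg l1 (ltnSn _) nfr sfr sS.
set s1 := upd _ _ _ in e1.
have s1a : map s1 (fr :: args) = g (map s args) :: map s args.
  by rewrite /= /s1 map_upd_lt // upd_same.
have e2 : exec (cf (fr :: args) dst fr.+1) s1
    (upd s1 dst (f (map s1 (fr :: args)))) (pb c2 k2 (esize (map s1 (fr :: args)))).
  apply: Hf; rewrite /= ?ltnSn //.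
  - by rewrite (leq_trans h2).
  - by rewrite inE negb_or h3 andbT neq_ltn h2.
  - by rewrite /s1; upd_tac.
  - by move=> j lj; rewrite /s1 upd_other ?sS //; lia.
rewrite s1a in e2; have e3 := exec_seq e1 (exec_seq e2 (exec_clear fr _) (ltnSn _)) (ltnSn _).
apply: exec_eq e3 _ _ => [j|]; rewrite /s1; first by upd_tac.
rewrite upd_other ?upd_same; last by lia.
have := @pb_mono c2 k2 _ _ (leq_add z1 (leqnn (esize (map s args)))).
by rewrite /esize /= -/(esize _) => z2; lia.
Qed.

(** Recursion on notation as in Cobham's characterization of polynomial time, where the size of all
    intermediate values has to be bounded in advance. *)
Fixpoint srec (g : seq str -> str) (h : bool -> seq str -> str) (w : str)
    (e : seq str) : str :=
  if w is b :: w' then h b (w' :: srec g h w' e :: e) else g e.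

(** The recursion starts from the end of the string, which is therefore reversed before the loop:
    the last bit is popped first, and values are computed for longer and longer suffixes. *)
Lemma FP_srec u g h c k : FP u -> FP g -> FP (h false) -> FP (h true) ->
  (forall e w, size w <= size (u e) -> size (srec g h w e) <= pb c k (esize e)) ->
  FP (fun e => srec g h (u e) e).
Proof.
move=> [cu [c1 [k1 Hu]]] [cg [c2 [k2 Hg]]] Fh0 Fh1 sz.
have [ch [ck [cd Hh]]] : exists ch c k, forall b, computes (ch b) (h b) (pb c k).
  move: Fh0 Fh1 => [ch0 [c3 [k3 H0]]] [ch1 [c4 [k4 H1]]].
  have [c' [k' le]] : polybd (fun n => pb c3 k3 n + pb c4 k4 n) by polybd.
  exists (fun b => if b then ch1 else ch0), c', k'; case => args dst fr s x1 x2 x3 x4 x5.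
    by apply: exec_mono (H1 _ _ _ _ x1 x2 x3 x4 x5) _; apply: leq_trans (le _); rewrite leq_addl.
  by apply: exec_mono (H0 _ _ _ _ x1 x2 x3 x4 x5) _; apply: leq_trans (le _); rewrite leq_addr.
(* Register [fr.+2] holds the suffix treated so far and [dst] its value. The new value is computed
   in [fr.+3] and reaches [dst] by two moves, which preserve the order of its bits. *)
pose body args dst fr b := Seq (ch b (fr.+2 :: dst :: args) fr.+3 fr.+4)
  (Seq (clear dst) (Seq (revmove fr.+3 fr) (Seq (revmove fr dst) (Push fr.+2 b)))).
pose B n := pb ck cd (pb c1 k1 n + pb c k n + n) + 8 * pb c k n + 20.
apply: (@FP_intro (fun args dst fr =>
   Seq (cu args fr fr.+1) (Seq (revmove fr fr.+1) (Seq (cg args dst fr.+4)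
    (Seq (Loop fr.+1 (body args dst fr false) (body args dst fr true)) (clear fr.+2))))) _
  (fun n => pb c1 k1 n + 3 * pb c1 k1 n + pb c2 k2 n + (B n + 2) * pb c1 k1 n
     + 2 * pb c1 k1 n + 20)); first by rewrite /B; polybd.
move=> args dst fr s h1 h2 h3 h4 h5.
have l i : fr <= i -> all (fun a => a < i) args by move=> li; apply: sub_all h1 => a; lia.
have ni i : fr <= i -> i \notin args by move=> li; apply/negP => /(allP h1); lia.
set e := map s args; set N := esize e.
have e1 : exec (cu args fr fr.+1) s (upd s fr (u e)) (pb c1 k1 N).
  by apply: (Hu args fr fr.+1 s (l _ (leqnSn _))); rewrite ?ni ?h5 // => j lj; apply: h5; lia.
have zu : size (u e) <= pb c1 k1 N.
  by apply: (computes_size Hu (l _ (leqnSn fr)) (ltnSn fr)); rewrite ?ni ?h5 // => j lj; apply: h5; lia.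
set s1 := upd _ _ _ in e1.
have n1 : fr.+1 <> fr by lia.
have e2 := exec_revmove s1 n1.
have s1f : s1 fr = u e by rewrite /s1 /upd eqxx.
have s1S : s1 fr.+1 = [::] by rewrite /s1 upd_other ?h5.
rewrite s1f s1S catrevE cats0 in e2.
set s2 := upd _ _ _ in e2.
pose s2' := upd s fr.+1 (rev (u e)).
have s22 : s2 = s2'.
  apply: functional_extensionality => i; rewrite /s2 /s1 /s2'; upd_tac; rewrite h5 //.
rewrite s22 in e2.
have s2e : map s2' args = e by rewrite /s2' map_upd_lt // l.
have e3 : exec (cg args dst fr.+4) s2' (upd s2' dst (g (map s2' args))) (pb c2 k2 (esize (map s2' args))).
  apply: Hg => //; first by apply: l; lia.
  - by lia.
  - by rewrite /s2'; upd_tac.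
  - by move=> j lj; rewrite /s2' upd_other ?h5 //; lia.
rewrite s2e -/N in e3.
(* With [w] still to be popped, the suffix treated is what remains of [u e] after [size w] bits. *)
pose I w := upd (upd (upd s fr.+1 w) fr.+2 (drop (size w) (u e))) dst
   (srec g h (drop (size w) (u e)) e).
have e4 : exec (Loop fr.+1 (body args dst fr false) (body args dst fr true))
   (I (rev (u e))) (I [::]) ((B N + 2) * size (rev (u e)) + 1).
  apply: exec_loop => [w'|v b w' vw]; first by rewrite /I; upd_tac.
  have ue : u e = rev w' ++ b :: rev v.
    by rewrite -[LHS]revK vw rev_cat rev_cons cat_rcons.
  have du : drop (size w') (u e) = b :: rev v by rewrite ue drop_size_cat ?size_rev.
  have du1 : drop (size w').+1 (u e) = rev v.
    by rewrite -addn1 addnC -drop_drop du /= drop0.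
  have zv : size (rev v) <= size (u e) by rewrite ue size_cat /=; lia.
  have zr : size (srec g h (rev v) e) <= pb c k N by apply: sz.
  have zr1 : size (srec g h (b :: rev v) e) <= pb c k N by apply: sz; rewrite ue size_cat /=; lia.
  have -> : (if b then body args dst fr true else body args dst fr false) = body args dst fr b by case: (b).
  rewrite /I /= du du1; set t0 := upd (upd _ _ _) _ _.
  have t0e : t0 = upd (upd (upd s fr.+1 w') fr.+2 (rev v)) dst (srec g h (rev v) e).
    by apply: functional_extensionality => i; rewrite /t0; upd_tac.
  rewrite t0e {t0 t0e}; set t0 := upd _ _ _.
  have t0m : map t0 (fr.+2 :: dst :: args) = [:: rev v, srec g h (rev v) e & e].
    rewrite /= {1}/t0 upd_other ?upd_same; last by lia.
    rewrite {1}/t0 upd_same; do 2!congr cons.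
    by rewrite /t0 map_upd_notin // map_upd_lt ?l 1?map_upd_lt ?l; [done|lia..].
  have x1 : exec (ch b (fr.+2 :: dst :: args) fr.+3 fr.+4) t0
      (upd t0 fr.+3 (h b (map t0 (fr.+2 :: dst :: args))))
      (pb ck cd (esize (map t0 (fr.+2 :: dst :: args)))).
    apply: Hh.
    - by rewrite /= l; lia.
    - exact: ltnSn.
    - by rewrite !inE !negb_or ni ?andbT; lia.
    - by rewrite /t0; upd_tac; rewrite h5 //; lia.
    - by move=> j lj; rewrite /t0; upd_tac; rewrite h5 //; lia.
  rewrite t0m in x1; set r' := srec g h (b :: rev v) e in zr1.
  rewrite -[h b _]/r' in x1; set t1 := upd t0 _ _ in x1.
  have x2 := exec_clear dst t1; set t2 := upd t1 _ _ in x2.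
  have t1d : t1 dst = srec g h (rev v) e by rewrite /t1 /t0; upd_tac.
  have n3 : fr <> fr.+3 by lia.
  have x3 := exec_revmove t2 n3.
  have t2a : t2 fr.+3 = r' by rewrite /t2 /t1; upd_tac.
  have t2b : t2 fr = [::] by rewrite /t2 /t1 /t0; upd_tac; rewrite h5.
  rewrite t2a t2b catrevE cats0 in x3; set t3 := upd (upd _ _ _) _ _ in x3.
  have n4 : dst <> fr by lia.
  have x4 := exec_revmove t3 n4.
  have t3a : t3 fr = rev r' by rewrite /t3; upd_tac.
  have t3d : t3 dst = [::] by rewrite /t3 /t2; upd_tac.
  rewrite t3a t3d catrevE cats0 revK in x4; set t4 := upd (upd _ _ _) _ _ in x4.
  have x5 := exec_push fr.+2 b t4 (ltnSn 0).
  have t4a : t4 fr.+2 = rev v by rewrite /t4 /t3 /t2 /t1 /t0; upd_tac.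
  rewrite t4a in x5.
  have := exec_seq x1 (exec_seq x2 (exec_seq x3 (exec_seq x4 x5 (ltnSn _)) (ltnSn _)) (ltnSn _)) (ltnSn _).
  move=> x; apply: exec_eq x _ _ => [i|].
    rewrite /t4 /t3 /t2 /t1 /t0.
    by upd_tac; rewrite h5 //; lia.
  rewrite t1d size_rev /B.
  have : pb ck cd (esize [:: rev v, srec g h (rev v) e & e]) <= pb ck cd (pb c1 k1 N + pb c k N + N).
    by apply: pb_mono; rewrite /esize /= -/(esize e) -/N; lia.
  by lia.
have Ie : upd s2' dst (g e) = I (rev (u e)).
  apply: functional_extensionality => i; rewrite /I size_rev drop_size /s2' /=.
  by upd_tac; rewrite h5 //; lia.
rewrite Ie in e3.
have e5 := exec_clear fr.+2 (I [::]).
have I2 : I [::] fr.+2 = u e by rewrite /I drop0; upd_tac.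
have := exec_seq e1 (exec_seq e2 (exec_seq e3 (exec_seq e4 e5 (ltnSn _)) (ltnSn _)) (ltnSn _)) (ltnSn _).
move=> x; apply: exec_eq x _ _ => [i|].
  by rewrite /I drop0; upd_tac; rewrite h5 //; lia.
rewrite I2 size_rev -/e -/N.
have : (B N + 2) * size (u e) <= (B N + 2) * pb c1 k1 N by rewrite leq_mul2l zu orbT.
by lia.
Qed.


(** * Register machines *)

(** Flow charts with finitely many control states, which can become states of a Turing machine. A
    pop has three successors: for the empty register and for the two bits. *)
Inductive instr (Q : Type) :=
  | IGoto of Q
  | IPush of nat & bool & Q
  | IPop of nat & Q & Q & Q.

Definition imap Q Q' (f : Q -> Q') (i : instr Q) : instr Q' :=
  match i with
  | IGoto q => IGoto (f q)
  | IPush j b q => IPush j b (f q)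
  | IPop j q0 qF qT => IPop j (f q0) (f qF) (f qT)
  end.

Definition ireg Q (i : instr Q) : nat :=
  match i with IGoto _ => 0 | IPush j _ _ => j | IPop j _ _ _ => j end.

Record RM := MkRM { rQ : finType; rstart : rQ; rexit : rQ; rins : rQ -> instr rQ }.

Definition istep Q (i : instr Q) (s : state) : Q * state :=
  match i with
  | IGoto q => (q, s)
  | IPush j b q => (q, upd s j (b :: s j))
  | IPop j q0 qF qT =>
      if s j is b :: w then (if b then qT else qF, upd s j w) else (q0, s)
  end.

Definition rstep (R : RM) (c : rQ R * state) : rQ R * state :=
  if c.1 == rexit R then c else istep (rins c.1) c.2.

Definition leads (R : RM) (c c' : rQ R * state) (t : nat) :=
  exists2 t', t' <= t & iter t' (@rstep R) c = c'.

Lemma leads_refl R (c : rQ R * state) : leads c c 0.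
Proof. by exists 0. Qed.

Lemma leads_le R (c c' : rQ R * state) t t' : leads c c' t -> t <= t' -> leads c c' t'.
Proof. by move=> [u le e] le'; exists u => //; apply: leq_trans le'. Qed.

Lemma leads_trans R (c1 c2 c3 : rQ R * state) t u :
  leads c1 c2 t -> leads c2 c3 u -> leads c1 c3 (t + u).
Proof.
move=> [t' le e] [u' le' e']; exists (u' + t'); first by rewrite addnC leq_add.
by rewrite iterD e.
Qed.

Lemma leads_step R (q : rQ R) s : q != rexit R -> leads (q, s) (istep (rins q) s) 1.
Proof. by move=> nq; exists 1; rewrite //= /rstep /= (negPf nq). Qed.

Lemma istep_imap Q Q' (f : Q -> Q') (i : instr Q) s :
  istep (imap f i) s = (f (istep i s).1, (istep i s).2).
Proof. by case: i => //= j q0 qF qT; case: (s j) => //= b w; case: b. Qed.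

(** Up to its exit a part runs as within the whole. The condition concerns other states only,
    because the whole may go on where the part stops. *)
Lemma leads_embed (R R' : RM) (f : rQ R -> rQ R') q s s' t :
  (forall q, q != rexit R -> (f q != rexit R') /\ rins (f q) = imap f (rins q)) ->
  leads (q, s) (rexit R, s') t -> leads (f q, s) (f (rexit R), s') t.
Proof.
move=> hf [t' le]; elim: t' t q s le => [|t' IH] t q s le.
  by case=> -> ->; apply: leads_le (leads_refl _) _.
rewrite iterSr; have [->|nq] := eqVneq q (rexit R).
  (* An idle step at the exit of the part has no counterpart in the whole and is dropped; [leads]
     only bounds the number of steps. *)
  by rewrite {2}/rstep /= eqxx; apply: IH; apply: ltnW.
rewrite {2}/rstep (negPf nq) /=; have [nf ef] := hf q nq.
case E : (istep _ _) => [q1 s1] h; case: t le h => // t le h.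
have {}h := IH t q1 s1 le h.
have h1 := leads_step s nf; rewrite ef istep_imap E /= in h1.
exact: leads_trans h1 h.
Qed.

Definition rm_seq (R1 R2 : RM) : RM := {|
  rQ := (rQ R1 + rQ R2)%type;
  rstart := inl (rstart R1); rexit := inr (rexit R2);
  rins := fun q => match q with
    | inl q => if q == rexit R1 then IGoto (inr (rstart R2)) else imap inl (rins q)
    | inr q => imap inr (rins q) end |}.

(** [inl false] tests the register and [inl true] is the exit. The test and the return from the body
    are the two extra steps in [exec_loop_cons]. *)
Definition rm_loop (j : nat) (R0 R1 : RM) : RM := {|
  rQ := (bool + (rQ R0 + rQ R1))%type;
  rstart := inl false; rexit := inl true;
  rins := fun q => match q with
    | inl _ => IPop j (inl true) (inr (inl (rstart R0))) (inr (inr (rstart R1)))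
    | inr (inl q) => if q == rexit R0 then IGoto (inl false)
                     else imap (fun q => inr (inl q)) (rins q)
    | inr (inr q) => if q == rexit R1 then IGoto (inl false)
                     else imap (fun q => inr (inr q)) (rins q) end |}.

Fixpoint compile (c : cmd) : RM :=
  match c with
  | Skip => {| rQ := unit; rstart := tt; rexit := tt; rins := fun=> IGoto tt |}
  | Push j b => {| rQ := bool; rstart := false; rexit := true; rins := fun=> IPush j b true |}
  | Seq c1 c2 => rm_seq (compile c1) (compile c2)
  | Loop j c0 c1 => rm_loop j (compile c0) (compile c1)
  end.

Fixpoint regbound (c : cmd) : nat :=
  match c with
  | Skip => 1
  | Push j b => j.+1
  | Seq c1 c2 => maxn (regbound c1) (regbound c2)
  | Loop j c0 c1 => maxn j.+1 (maxn (regbound c0) (regbound c1))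
  end.

Lemma ireg_imap Q Q' (f : Q -> Q') i : ireg (imap f i) = ireg i.
Proof. by case: i. Qed.

Lemma compile_reg c (q : rQ (compile c)) : ireg (rins q) < regbound c.
Proof.
elim: c q => [|j b|c1 IH1 c2 IH2|j c0 IH0 c1 IH1] //=.
- move=> [] q; rewrite ?(fun_if (@ireg _)) ?ireg_imap leq_max ?IH1 ?IH2 ?orbT //.
  by case: ifP => //=; rewrite (leq_ltn_trans _ (IH1 q)).
- move=> [b|[] q]; rewrite ?(fun_if (@ireg _)) ?ireg_imap !leq_max /= ?ltnSn //.
    by case: ifP => _; rewrite ?IH0 ?orbT //.
  by case: ifP => _; rewrite ?IH1 ?orbT //.
Qed.

Lemma exec_leads c s s' t : exec c s s' t ->
  leads (rstart (compile c), s) (rexit (compile c), s') t.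
Proof.
elim=> {c s s' t}.
- by move=> s t; exists 0.
- by move=> j b s t t0; exists 1 => //=; rewrite /rstep.
- move=> c1 c2 s1 s2 s3 t1 t2 t _ IH1 _ IH2 lt.
  have h1 := @leads_embed _ (rm_seq (compile c1) (compile c2)) inl _ _ _ _ _ IH1.
  have h2 := @leads_embed _ (rm_seq (compile c1) (compile c2)) inr _ _ _ _ _ IH2.
  have h : leads (R := rm_seq (compile c1) (compile c2))
    (inl (rexit (compile c1)), s2) (inr (rstart (compile c2)), s2) 1.
    by exists 1; rewrite //= /rstep /= eqxx.
  apply: leads_le (leads_trans (h1 _) (leads_trans h (h2 _))) _; last by lia.
    by move=> q nq /=; rewrite (negPf nq).
  by move=> q nq /=; split=> //; apply: contra nq => /eqP[->].
- by move=> j c0 c1 s t sj t0; exists 1 => //=; rewrite /rstep /= sj.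
- move=> j c0 c1 b w s s1 s2 t1 t2 t sj _ IH1 _ IH2 le.
  pose R := rm_loop j (compile c0) (compile c1).
  pose f : rQ (compile (if b then c1 else c0)) -> rQ R :=
    if b is true then fun q => inr (inr q) else fun q => inr (inl q).
  have h0 : leads (R := R) (inl false, s) (f (rstart _), upd s j w) 1.
    by exists 1 => //=; rewrite /rstep /= sj /f; case: (b).
  have h1 : leads (R := R) (f (rstart _), upd s j w) (f (rexit _), s1) t1.
    apply: leads_embed IH1; rewrite /f; case: (b) => q nq;
    by split=> //=; rewrite (negPf nq).
  have h2 : leads (R := R) (f (rexit _), s1) (inl false, s1) 1.
    by exists 1 => //=; rewrite /rstep /f; case: (b); rewrite /= eqxx.
  by apply: leads_le (leads_trans h0 (leads_trans h1 (leads_trans h2 IH2))) _; lia.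
Qed.

(** * Simulation by a single-tape Turing machine *)

(* The registers [0 .. k-1] are laid out on the tape from left to right, each
   followed by a blank. Between two instructions the head is [Home], on the first
   cell of register 0. Pushing inserts a cell by carrying the rest of the tape one
   cell to the right ([Carry]); popping goes to the last separator ([GoEnd]) and
   moves the rest of the tape one cell to the left ([Shift]). The counters are
   numbers of separators still to be met. *)
Inductive phase (k : nat) :=
  | Home
  | SkipTo of 'I_k.+1
  | Carry of option bool & 'I_k.+1
  | Ret of 'I_k.+1
  | GoEnd of 'I_k.+1 & 'I_k.+1
  | Shift of option bool & 'I_k.+1 & 'I_k.+1.
Arguments Home {k}.

Definition phase_enc k (p : phase k) :
    ('I_6 * option bool * 'I_k.+1 * 'I_k.+1)%type :=
  match p with
  | Home => (inord 0, None, ord0, ord0)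
  | SkipTo c => (inord 1, None, ord0, c)
  | Carry a c => (inord 2, a, ord0, c)
  | Ret c => (inord 3, None, ord0, c)
  | GoEnd j c => (inord 4, None, j, c)
  | Shift a j c => (inord 5, a, j, c)
  end.

Definition phase_dec k (x : 'I_6 * option bool * 'I_k.+1 * 'I_k.+1) : phase k :=
  let: (t, a, j, c) := x in
  match val t with
  | 0 => Home | 1 => SkipTo c | 2 => Carry a c | 3 => Ret c
  | 4 => GoEnd j c | _ => Shift a j c
  end.

Lemma phase_encK k : cancel (@phase_enc k) (@phase_dec k).
Proof. by case=> [|c|a c|c|j c|a j c]; rewrite /phase_dec /= inordK. Qed.

HB.instance Definition _ k := Finite.copy (phase k) (can_type (@phase_encK k)).

Section Simulation.
Variables (R : RM) (k : nat).
Hypothesis hk : forall q : rQ R, ireg (rins q) < k.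

(** Once an instruction is decoded, the control state is already the next one, and the remaining
    phases only repair the tape. [Ret c] passes [c] separators and recognizes register 0 by the
    blank to its left. *)
Definition sim_delta (st : rQ R * phase k) (a : option bool) :
    (rQ R * phase k) * option bool * move :=
  let: (q, ph) := st in
  match ph with
  | Home => if rins q is IGoto q' then ((q', Home), a, Stay)
            else ((q, SkipTo (inord (ireg (rins q)))), a, Stay)
  | SkipTo c =>
      if c == 0 :> nat then
        match rins q with
        | IGoto q' => ((q', Home), a, Stay)
        | IPush j b q' => ((q', Carry (Some b) (inord (k - j))), a, Stay)
        | IPop j q0 qF qT =>
            if a is Some b
            then ((if b then qT else qF, GoEnd (inord j) (inord (k - j))), a, Stay)
            else ((q0, Ret (inord j.+1)), a, Stay)
        end
      else ((q, SkipTo (if a == None then inord c.-1 else c)), a, MoveR)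
  | Carry w c =>
      if w is None then
        if c == 1 :> nat then ((q, Ret (inord k)), None, Stay)
        else ((q, Carry a (inord c.-1)), None, MoveR)
      else ((q, Carry a c), w, MoveR)
  | Ret c =>
      if a is None then
        if c == 0 :> nat then ((q, Home), None, MoveR)
        else ((q, Ret (inord c.-1)), None, MoveL)
      else ((q, Ret c), a, MoveL)
  | GoEnd j c =>
      if a is None then
        if c == 1 :> nat then ((q, Shift None j (inord (k - j).-1)), None, MoveL)
        else ((q, GoEnd j (inord c.-1)), None, MoveR)
      else ((q, GoEnd j c), a, MoveR)
  | Shift w j c =>
      if a is None then
        if c == 0 :> nat then ((q, Ret j), None, Stay)
        else ((q, Shift None j (inord c.-1)), w, MoveL)
      else ((q, Shift a j c), w, MoveL)
  end.

Definition sim_TM : TM := {|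
  tm_state := (rQ R * phase k)%type;
  tm_start := (rstart R, Home);
  tm_halt := pred1 (rexit R, Home);
  tm_delta := sim_delta |}.

Definition tleads (c c' : config sim_TM) (t : nat) :=
  exists2 t', t' <= t & iter t' (@tm_step sim_TM) c = c'.

Lemma tleads_refl c : tleads c c 0.
Proof. by exists 0. Qed.

Lemma tleads_trans c1 c2 c3 t u : tleads c1 c2 t -> tleads c2 c3 u -> tleads c1 c3 (t + u).
Proof.
move=> [t' le e] [u' le' e']; exists (u' + t'); first by rewrite addnC leq_add.
by rewrite iterD e.
Qed.

Lemma tleads_eq c c1 c2 t t' : tleads c c1 t -> c1 = c2 -> t <= t' -> tleads c c2 t'.
Proof. by move=> [u le e] <- le'; exists u => //; apply: leq_trans le'. Qed.

(** The cell under the head is the first of [r], so that a moving head passes cells from one list to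
    the other; an empty list stands for blanks. *)
Definition tcfg (q : rQ R) (ph : phase k) (l r : seq (option bool)) : config sim_TM :=
  ((q, ph), (l, head None r, behead r)).

Definition tmove (mv : move) (w : option bool) (l r : seq (option bool)) :
    seq (option bool) * seq (option bool) :=
  match mv with
  | Stay => (l, w :: behead r)
  | MoveR => (w :: l, behead r)
  | MoveL => (behead l, head None l :: w :: behead r)
  end.

Arguments sim_delta : simpl never.

Lemma tleads_step q ph l r : (q, ph) != (rexit R, Home) ->
  let: (q', ph', w, mv) := sim_delta (q, ph) (head None r) in
  tleads (tcfg q ph l r) (tcfg q' ph' (tmove mv w l r).1 (tmove mv w l r).2) 1.
Proof.
move=> nh; case E : (sim_delta _ _) => [[[q' ph'] w] mv]; exists 1 => //=.
rewrite -[(q, ph) == _]/((q, ph) == _) (negPf nh) E.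
by case: mv {E} => //=; [case: l|case: (behead r)].
Qed.

Lemma phase_step q ph l r : (if ph is Home then false else true) ->
  let: (q', ph', w, mv) := sim_delta (q, ph) (head None r) in
  tleads (tcfg q ph l r) (tcfg q' ph' (tmove mv w l r).1 (tmove mv w l r).2) 1.
Proof.
move=> nh; apply: tleads_step; apply/eqP => -[_ eh].
by rewrite eh in nh.
Qed.

Lemma last_none_nil (u : seq (option bool)) :
  last None u = None -> count_mem None u = 0 -> u = [::].
Proof.
case/lastP: u => // u a; rewrite last_rcons => ->.
by rewrite -cats1 count_cat /= addn1.
Qed.

Lemma run_skip q (u l z : seq (option bool)) c : c <= k -> last None u = None -> count_mem None u = c ->
  tleads (tcfg q (SkipTo (inord c)) l (u ++ z))
         (tcfg q (SkipTo (inord 0)) (rev u ++ l) z) (size u).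
Proof.
elim: u l c => [|a u IH] l c lc lu cu; first by rewrite -cu; apply: tleads_refl.
have c0 : (c == 0) = false.
  by apply/eqP => c0; have := last_none_nil lu; rewrite cu c0 => /(_ erefl).
have := @phase_step q (SkipTo (inord c)) l ((a :: u) ++ z) isT.
rewrite /sim_delta /= inordK // c0.
have -> : (if a == None then inord c.-1 else inord c) = inord (c - (a == None)) :> 'I_k.+1.
  by case: eqP => _; rewrite ?subn1 ?subn0.
move=> h; rewrite rev_cons cat_rcons -(add1n (size u)).
apply: tleads_trans h _.
apply: IH; first by lia.
- by case: (a) (u) lu => [b|] [].
- by rewrite -cu /=; lia.
Qed.

(** The first cell of [z] is overwritten; in the application it lies beyond all registers. *)
Lemma run_carry q a (u l z : seq (option bool)) c : c <= k -> last a u = None -> count_mem None (a :: u) = c ->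
  tleads (tcfg q (Carry a (inord c)) l (u ++ z))
         (tcfg q (Ret (inord k)) (rev (belast a u) ++ l) (None :: behead z)) (size u).+1.
Proof.
elim: u a l c => [|b u IH] a l c lc la ca.
  have := @phase_step q (Carry a (inord c)) l z isT.
  by rewrite /sim_delta /= in la ca *; rewrite la in ca *; rewrite inordK // -ca.
have := @phase_step q (Carry a (inord c)) l ((b :: u) ++ z) isT.
rewrite /sim_delta /= inordK // rev_cons cat_rcons -add1n => h.
have cb : 0 < count_mem None (b :: u).
  rewrite lt0n; apply/eqP => cb.
  have : last None (b :: u) = None by [].
  by move/last_none_nil/(_ cb).
case: a la ca h => [a|] la ca h.
  by apply: tleads_trans h _; apply: IH.
have c1 : (c == 1) = false by apply/eqP => c1; move: ca cb; rewrite c1 /=; lia.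
rewrite c1 in h; apply: tleads_trans h _; apply: IH => //; first by lia.
by rewrite -ca.
Qed.

Lemma run_ret q w a (l r l1 : seq (option bool)) c : c <= k -> a :: l = w ++ l1 -> head None l1 = None ->
  count_mem None w = c ->
  tleads (tcfg q (Ret (inord c)) l (a :: r)) (tcfg q Home (None :: behead l1) (rev w ++ r))
    (size w).+1.
Proof.
elim: w a l r l1 c => [|b w IH] a l r l1 c lc al l1N cw.
  have := @phase_step q (Ret (inord c)) l (a :: r) isT.
  by move: l1N; rewrite -[l1]al /sim_delta /= => ->; rewrite inordK // -cw.
case: al => ab ->; rewrite {}ab {a}.
have h : tleads (tcfg q (Ret (inord c)) (w ++ l1) (b :: r))
    (tcfg q (Ret (inord (c - (b == None)))) (behead (w ++ l1))
       (head None (w ++ l1) :: b :: r)) 1.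
  have := @phase_step q (Ret (inord c)) (w ++ l1) (b :: r) isT.
  rewrite /sim_delta; case: b cw => [b|] cw /=; first by rewrite subn0.
  by rewrite inordK // ifN ?subn1 //; apply/eqP; rewrite -cw.
rewrite rev_cons cat_rcons -add1n.
have cw' : count_mem None w = c - (b == None) by rewrite -cw /=; lia.
(* Where the list of cells on the left ends, the blank border is not yet in the list and has to be
   supplied. *)
have [wl|wl] := eqVneq (w ++ l1) [::].
  have [w0 l10] : w = [::] /\ l1 = [::] by case: (w) (l1) wl => [|? ?] [|? ?].
  subst w l1; apply: tleads_trans h _.
  by apply: (IH _ _ _ [:: None]) => //; lia.
apply: tleads_trans h _; apply: IH => //; first by lia.
by case: (w ++ l1) wl.
Qed.

Lemma run_goend q j (u l z : seq (option bool)) c : c < k -> count_mem None u = c ->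
  tleads (tcfg q (GoEnd j (inord c.+1)) l (u ++ None :: z))
         (tcfg q (GoEnd j (inord 1)) (rev u ++ l) (None :: z)) (size u).
Proof.
elim: u l c => [|a u IH] l c lc cu; first by rewrite -cu; apply: tleads_refl.
have := @phase_step q (GoEnd j (inord c.+1)) l ((a :: u) ++ None :: z) isT.
rewrite /sim_delta /= inordK // rev_cons cat_rcons -add1n.
case: a cu => [a|] cu h; first by apply: tleads_trans h (IH _ _ lc _).
rewrite /= add1n in cu; rewrite -cu /= in lc h *.
by apply: tleads_trans h (IH _ _ _ _) => //; lia.
Qed.

(** The symbols move left by one cell, and the leftmost one, the last of [w], is lost: this is the
    bit popped. *)
Lemma run_shift q w b (l r l1 : seq (option bool)) x j c : c <= k -> b :: l = w ++ l1 -> head None l1 = None ->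
  count_mem None w = c ->
  tleads (tcfg q (Shift x j (inord c)) l (b :: r))
         (tcfg q (Ret j) (behead l1) (None :: rev (belast x w) ++ r)) (size w).+1.
Proof.
elim: w b l r l1 x c => [|a w IH] b l r l1 x c lc bl l1N cw.
  have := @phase_step q (Shift x j (inord c)) l (b :: r) isT.
  by move: l1N; rewrite -[l1]bl /sim_delta /= => ->; rewrite inordK // -cw.
case: bl => ab ->; rewrite {}ab {b}.
have h : tleads (tcfg q (Shift x j (inord c)) (w ++ l1) (a :: r))
    (tcfg q (Shift a j (inord (c - (a == None)))) (behead (w ++ l1))
       (head None (w ++ l1) :: x :: r)) 1.
  have := @phase_step q (Shift x j (inord c)) (w ++ l1) (a :: r) isT.
  rewrite /sim_delta; case: a cw => [b|] cw /=; first by rewrite subn0.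
  by rewrite inordK // ifN ?subn1 //; apply/eqP; rewrite -cw.
rewrite /= rev_cons cat_rcons -add1n.
have cw' : count_mem None w = c - (a == None) by rewrite -cw /=; lia.
have [wl|wl] := eqVneq (w ++ l1) [::].
  have [w0 l10] : w = [::] /\ l1 = [::] by case: (w) (l1) wl => [|? ?] [|? ?].
  subst w l1; apply: tleads_trans h _.
  by apply: (IH _ _ _ [:: None]) => //; lia.
apply: tleads_trans h _; apply: IH => //; first by lia.
by case: (w ++ l1) wl.
Qed.

Definition block (v : str) : seq (option bool) := rcons (map Some v) None.
Definition layout (s : state) j n := flatten [seq block (s i) | i <- iota j n].

Lemma count_block v : count_mem None (block v) = 1.
Proof. by rewrite /block -cats1 count_cat /= addn1; elim: v. Qed.

Lemma layout_count s j n : count_mem None (layout s j n) = n.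
Proof. by elim: n j => //= n IH j; rewrite count_cat count_block /= IH. Qed.

Lemma layout_last s j n : last None (layout s j n) = None.
Proof. by elim: n j => //= n IH j; rewrite last_cat last_rcons IH. Qed.

Lemma layout_split s j : j < k ->
  layout s 0 k = layout s 0 j ++ block (s j) ++ layout s j.+1 (k - j.+1).
Proof.
move=> jk; rewrite /layout -{1}(subnKC jk) -addn1 !iotaD !map_cat !flatten_cat /=.
by rewrite cats0 add0n -catA addn1.
Qed.

Lemma layout_upd s j v : j < k ->
  layout (upd s j v) 0 k = layout s 0 j ++ block v ++ layout s j.+1 (k - j.+1).
Proof.
move=> jk; rewrite (layout_split _ jk) upd_same; congr (_ ++ (_ ++ _)); congr flatten.
  by apply/eq_in_map => i; rewrite mem_iota => h; rewrite upd_other //; lia.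
by apply/eq_in_map => i; rewrite mem_iota => h; rewrite upd_other //; lia.
Qed.

Lemma sim_goto_reg q (P : seq (option bool)) l (r : seq (option bool)) j :
  j < k -> ireg (rins q) = j -> q != rexit R ->
  (if rins q is IGoto _ then false else true) ->
  last None P = None -> count_mem None P = j ->
  tleads (tcfg q Home l (P ++ r)) (tcfg q (SkipTo (inord 0)) (rev P ++ l) r)
    (size P).+1.
Proof.
move=> jk qj nq ng lP cP.
have nh : (q, Home) != (rexit R, Home : phase k) by apply: contra nq => /eqP[->].
have h0 : tleads (tcfg q Home l (P ++ r)) (tcfg q (SkipTo (inord j)) l (P ++ r)) 1.
  have := tleads_step l (P ++ r) nh; rewrite /sim_delta /= qj.
  by case: (rins q) ng.
exact: tleads_trans h0 (run_skip _ _ _ (ltnW jk) lP cP).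
Qed.

Lemma sim_push q j b q' s l z : q != rexit R -> rins q = IPush j b q' ->
  head None l = None ->
  tleads (tcfg q Home l (layout s 0 k ++ z))
    (tcfg q' Home (None :: behead l) (layout (upd s j (b :: s j)) 0 k ++ behead z))
    (4 * size (layout s 0 k) + 10).
Proof.
move=> nq E lN; have jk : j < k by have := hk q; rewrite E.
rewrite layout_upd // (layout_split s jk).
set P := layout s 0 j; set Q := layout _ _ _; set u := block (s j) ++ Q.
have cP : count_mem None P = j by apply: layout_count.
have lP : last None P = None by apply: layout_last.
have lu : last (Some b) u = None by rewrite last_cat last_rcons layout_last.
have cu : count_mem None (Some b :: u) = k - j.
  by rewrite /= count_cat count_block layout_count; lia.
have bu : Some b :: u = rcons (belast (Some b) u) None by rewrite lastI lu.
have ng : is_true (if rins q is IGoto _ then false else true) by rewrite E.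
have h1 : tleads _ _ _ :=
  @sim_goto_reg q P l (u ++ z) j jk (f_equal _ E) nq ng lP cP.
have h2 : tleads (tcfg q (SkipTo (inord 0)) (rev P ++ l) (u ++ z))
    (tcfg q' (Carry (Some b) (inord (k - j))) (rev P ++ l) (u ++ z)) 1.
  have := @phase_step q (SkipTo (inord 0)) (rev P ++ l) (u ++ z) isT.
  by rewrite /sim_delta /= inordK // E.
have h3 := run_carry q' (rev P ++ l) z (leq_subr j k) lu cu.
have h4 := @run_ret q' (rev (P ++ Some b :: u)) None
  (rev (belast (Some b) u) ++ rev P ++ l) (behead z) l k (leqnn _) _ lN _.
have h := tleads_trans h1 (tleads_trans h2 (tleads_trans h3 (h4 _ _))).
rewrite -(catA P) -/u; apply: tleads_eq (h _ _) _ _.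
- by rewrite bu rev_cat rev_rcons -!catA.
- by rewrite count_rev count_cat cu cP; lia.
- by rewrite revK /block /= -catA.
- by rewrite size_rev /u !size_cat /= !size_cat; lia.
Qed.

Lemma sim_pop q j q0 qF qT s l z : q != rexit R -> rins q = IPop j q0 qF qT ->
  head None l = None ->
  exists z', tleads (tcfg q Home l (layout s 0 k ++ z))
    (let c := istep (IPop j q0 qF qT) s in
     tcfg c.1 Home (None :: behead l) (layout c.2 0 k ++ z'))
    (4 * size (layout s 0 k) + 10).
Proof.
move=> nq E lN; have jk : j < k by have := hk q; rewrite E.
rewrite (layout_split s jk).
set P := layout s 0 j; set Q := layout _ _ _; set u := block (s j) ++ Q.
have cP : count_mem None P = j by apply: layout_count.
have lP : last None P = None by apply: layout_last.
have ng : is_true (if rins q is IGoto _ then false else true) by rewrite E.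
have h1 : tleads _ _ _ :=
  @sim_goto_reg q P l (u ++ z) j jk (f_equal _ E) nq ng lP cP.
rewrite -(catA P) -/u /=; case sj : (s j) => [|b w0] /=.
  exists z; have eu : u = None :: Q by rewrite /u sj.
  have h2 : tleads (tcfg q (SkipTo (inord 0)) (rev P ++ l) (u ++ z))
      (tcfg q0 (Ret (inord j.+1)) (rev P ++ l) (u ++ z)) 1.
    have := @phase_step q (SkipTo (inord 0)) (rev P ++ l) (u ++ z) isT.
    by rewrite /sim_delta /= inordK // E eu.
  have h3 := @run_ret q0 (None :: rev P) None (rev P ++ l) (Q ++ z) l j.+1 jk erefl lN _.
  rewrite eu in h1 h2 *; have h := tleads_trans h1 (tleads_trans h2 (h3 _)).
  apply: tleads_eq (h _) _ _.
  - by rewrite /= count_rev cP.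
  - by rewrite (layout_split s jk) sj -/P -/Q rev_cons revK cat_rcons -!catA.
  - by rewrite /= size_rev !size_cat /=; lia.
exists (None :: z); rewrite layout_upd // -/P -/Q.
have [y yy] : exists y, block w0 ++ Q = rcons y None.
  have : last None (block w0 ++ Q) = None by rewrite last_cat last_rcons layout_last.
  have : 0 < size (block w0 ++ Q) by rewrite size_cat size_rcons.
  by case/lastP: (block w0 ++ Q) => // y a _; rewrite last_rcons => ->; exists y.
have eu : u = Some b :: rcons y None by rewrite -yy /u sj.
have cy : count_mem None y = k - j.+1.
  have : count_mem None (rcons y None) = (k - j.+1).+1.
    by rewrite -yy count_cat count_block layout_count.
  by rewrite -cats1 count_cat /= addn1 => -[].
rewrite yy; set q1 := (if b then qT else qF).
have h2 : tleads (tcfg q (SkipTo (inord 0)) (rev P ++ l) (u ++ z))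
    (tcfg q1 (GoEnd (inord j) (inord (k - j.+1).+1)) (rev P ++ l) (u ++ z)) 1.
  have := @phase_step q (SkipTo (inord 0)) (rev P ++ l) (u ++ z) isT.
  rewrite /sim_delta /= inordK // E eu /= -/q1.
  by have -> : k - j = (k - j.+1).+1 by lia.
have kj : k - j.+1 < k by lia.
have h3 := @run_goend q1 (inord j) (Some b :: y) (rev P ++ l) z _ kj cy.
pose L := rev (Some b :: y) ++ rev P ++ l.
have h4 : tleads (tcfg q1 (GoEnd (inord j) (inord 1)) L (None :: z))
    (tcfg q1 (Shift None (inord j) (inord (k - j.+1))) (behead L)
       (head None L :: None :: z)) 1.
  have := @phase_step q1 (GoEnd (inord j) (inord 1)) L (None :: z) isT.
  rewrite /sim_delta /= !inordK /=; [|by lia..].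
  by have -> : (k - j).-1 = k - j.+1 by lia.
have l1N : head None (rev P ++ l) = None.
  by case/lastP: (P) lP => [|P' a]; rewrite ?last_rcons ?rev_rcons //= => ->.
have eL : head None L :: behead L = rev (Some b :: y) ++ rev P ++ l.
  by rewrite -/L; case EL : L => //; move/(congr1 size): EL; rewrite size_cat size_rev.
have h5 := @run_shift q1 (rev (Some b :: y)) (head None L) (behead L) (None :: z)
  (rev P ++ l) None (inord j) (k - j.+1) (ltnW kj) eL l1N _.
have e5 : rev (belast None (rev (Some b :: y))) ++ None :: z = rcons y None ++ None :: z.
  by rewrite rev_cons belast_rcons rev_cons revK.
rewrite e5 in h5.
have h6 : tleads (tcfg q1 (Ret (inord j)) (behead (rev P ++ l)) (None :: rcons y None ++ None :: z))
    (tcfg q1 Home (None :: behead l) (P ++ rcons y None ++ None :: z)) (size P).+1.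
  case/lastP: (P) lP cP => [_ j0|P' a].
    by apply: (@run_ret q1 [::] None (behead l) _ (None :: behead l)) => //; lia.
  rewrite last_rcons rev_rcons => -> cP'.
  have := @run_ret q1 (rev (rcons P' None)) None (rev P' ++ l) (rcons y None ++ None :: z) l j.
  by rewrite revK rev_rcons size_rcons /= size_rev; apply; rewrite // ?count_rev -?cP'; [lia| rewrite -cats1 count_cat /=; lia].
have e1 : u ++ z = (Some b :: y) ++ None :: z by rewrite eu /= cat_rcons.
rewrite e1 in h1 h2.
have h := tleads_trans h1 (tleads_trans h2 (tleads_trans h3 (tleads_trans h4 (tleads_trans (h5 _) h6)))).
rewrite -catA -/u e1; apply: tleads_eq (h _) _ _.
- by rewrite count_rev /= cy.
- by [].
- by rewrite size_rev eu size_cat /= size_rcons; lia.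
Qed.

(** Outside the registers only the cell left of register 0 matters: it has to be blank, since it
    stops the returning head. The rest of the tape is quantified existentially. *)
Lemma sim_step q s l z : q != rexit R -> head None l = None ->
  exists l' z', head None l' = None /\
    tleads (tcfg q Home l (layout s 0 k ++ z))
      (let c := istep (rins q) s in tcfg c.1 Home l' (layout c.2 0 k ++ z'))
      (4 * size (layout s 0 k) + 10).
Proof.
move=> nq lN; case E : (rins q) => [q'|j b q'|j q0 qF qT].
- exists l, z; split=> //.
  have nh : (q, Home) != (rexit R, Home : phase k) by apply: contra nq => /eqP[->].
  have := tleads_step l (layout s 0 k ++ z) nh; rewrite /sim_delta /= E => h.
  by apply: tleads_eq h _ _ => //; lia.
- by exists (None :: behead l), (behead z); split=> //; apply: sim_push E lN.
- have [z' h] := sim_pop s z nq E lN.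
  by exists (None :: behead l), z'.
Qed.

Lemma istep_size (i : instr (rQ R)) s j : size ((istep i s).2 j) <= (size (s j)).+1.
Proof.
case: i => [q|j' b q|j' q0 qF qT] //=; first by rewrite /upd; case: eqP => [->|].
by case sj : (s j') => [|b w] //=; rewrite /upd; case: eqP => // ->; rewrite sj /=; lia.
Qed.

Lemma istep_layout (i : instr (rQ R)) s n :
  size (layout (istep i s).2 0 n) <= size (layout s 0 n) + n.
Proof.
rewrite /layout; elim: n 0 => //= n IH j.
rewrite !size_cat /block !size_rcons !size_map.
by have := istep_size i s j; have := IH j.+1; rewrite /block; lia.
Qed.

(** An instruction lengthens the layout by at most [k] cells, so that [t * k] bounds its growth
    during the whole run. *)
Lemma sim_run t q s q' s' l z : iter t (@rstep R) (q, s) = (q', s') ->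
  head None l = None ->
  exists l' z', head None l' = None /\
    tleads (tcfg q Home l (layout s 0 k ++ z)) (tcfg q' Home l' (layout s' 0 k ++ z'))
      (t * (4 * (size (layout s 0 k) + t * k) + 10)).
Proof.
elim: t q s l z => [|t IH] q s l z.
  by case=> <- <- lN; exists l, z; split=> //; apply: tleads_refl.
rewrite iterSr {2}/rstep /=; case: eqP => [->|/eqP nq] h lN.
  have [l' [z' [lN' h']]] := IH _ _ l z h lN.
  exists l', z'; split=> //; apply: tleads_eq h' erefl _.
  by apply: leq_mul; lia.
have [l1 [z1 [l1N h1]]] := sim_step s z nq lN.
case Ei : (istep _ _) h h1 => [q1 s1] /= h h1.
have [l' [z' [lN' h']]] := IH _ _ l1 z1 h l1N.
exists l', z'; split=> //; apply: tleads_eq (tleads_trans h1 h') erefl _.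
have sz : size (layout s1 0 k) <= size (layout s 0 k) + k.
  by have := istep_layout (rins q) s k; rewrite Ei.
have : t * (4 * (size (layout s1 0 k) + t * k) + 10) <=
       t * (4 * (size (layout s 0 k) + t.+1 * k) + 10).
  by rewrite leq_mul2l leq_add2r leq_mul2l mulSn; apply/orP; right; lia.
by rewrite mulSn; lia.
Qed.

End Simulation.

(* The initial tape holds register 0 only: the separators of the empty registers are
   among the blanks to its right. *)
Definition blank_ext (M : TM) (c d : config M) :=
  exists n, d = (c.1, (c.2.1, c.2.2 ++ nseq n None)).

Lemma blank_ext_step M (c d : config M) : blank_ext c d -> blank_ext (tm_step M c) (tm_step M d).
Proof.
case: c => q [[l h] r] [n ->] /=; case: ifP => hq; first by exists n.
case: (tm_delta _ _ _) => [[q' w] []] /=.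
- by case: l => [|a l]; exists n.
- case: r => [|a r]; last by exists n.
  by case: n => [|n]; [exists 0|exists n].
- by exists n.
Qed.

Lemma blank_ext_iter M (c d : config M) t :
  blank_ext c d -> blank_ext (iter t (tm_step M) c) (iter t (tm_step M) d).
Proof. by move=> cd; elim: t => //= t; apply: blank_ext_step. Qed.

Lemma blank_ext_output M (c d : config M) : blank_ext c d -> tm_output M c = tm_output M d.
Proof.
case: c => q [[l h] r] [n ->] /=; case: h => // b; congr (_ :: _).
by elim: r => [|[a|] r IH] /=; rewrite ?IH //; case: n.
Qed.

Lemma layout_init x k : 0 < k ->
  layout (upd (fun=> [::]) 0 x) 0 k = map Some x ++ nseq k None.
Proof.
move=> k0; rewrite layout_upd //= /block -cats1 -catA; congr (_ ++ _).
have -> j n : layout (fun=> [::]) j n = nseq n None by elim: n j => //= n IH j; rewrite -(IH j.+1).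
by rewrite -[in RHS](subnK k0) addn1.
Qed.

(* Registers 0 and 1 are the argument and the result of [comp [:: 0] 1 2]; the
   result is then moved to register 0, where the head ends. *)
Theorem FP_runs (f : seq str -> str) : FP f ->
  exists (M : TM) (c k : nat), forall x,
    exists2 t, t <= poly_bound c k (size x) & runs M x t (f [:: x]).
Proof.
move=> [comp [c [d Hf]]].
pose p := Seq (comp [:: 0] 1 2) (Seq (clear 0) (Seq (revmove 1 2) (revmove 2 0))).
pose R := compile p; pose k := regbound p; pose M := sim_TM R k.
have hk : forall q : rQ R, ireg (rins q) < k by apply: compile_reg.
have k0 : 0 < k by apply: leq_ltn_trans (hk (rstart R)).
have pe x : exists2 t, t <= pb c d (size x) + 2 * size x + 6 * pb c d (size x) + 20 &
    exists s' : state, s' 0 = f [:: x] /\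
    exec p (upd (fun=> [::]) 0 x) s' t.
  set s0 := upd _ _ _.
  have s0m : map s0 [:: 0] = [:: x] by rewrite /= /s0 upd_same.
  have e1 : exec (comp [:: 0] 1 2) s0 (upd s0 1 (f [:: x])) (pb c d (size x)).
    have := Hf [:: 0] 1 2 s0; rewrite s0m /esize /= addn0; apply=> // j.
    by rewrite /s0 /upd; case: j.
  have z1 : size (f [:: x]) <= pb c d (size x).
    by have := exec_size 1 e1; rewrite upd_same.
  set s1 := upd s0 _ _ in e1; have e2 := exec_clear 0 s1; set s2 := upd s1 _ _ in e2.
  have n1 : 2 <> 1 by []. have n2 : 0 <> 2 by [].
  have e3 := exec_revmove s2 n1; set s3 := upd (upd _ _ _) _ _ in e3.
  have e4 := exec_revmove s3 n2; set s4 := upd (upd _ _ _) _ _ in e4.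
  have e := exec_seq e1 (exec_seq e2 (exec_seq e3 e4 (ltnSn _)) (ltnSn _)) (ltnSn _).
  have s31 : s3 2 = rev (f [:: x]).
    by rewrite /s3 /s2 /s1 /s0 /upd /= catrevE cats0.
  exists (pb c d (size x) + 2 * size x + 6 * pb c d (size x) + 20) => //.
  exists s4; split.
    by rewrite /s4 upd_other // upd_same s31 /s3 /s2 /upd /= catrevE cats0 revK.
  apply: exec_mono e _; rewrite s31 size_rev.
  by rewrite /s2 /s1 /s0 /upd /=; lia.
pose T n := pb c d n + 2 * n + 6 * pb c d n + 20.
have [c' [d' Tb]] : polybd (fun n => T n * (4 * (n + k + T n * k) + 10)).
  by rewrite /T; polybd.
exists M, (c' * 2 ^ d'), d' => x; have [t le [s' [s'0 e]]] := pe x.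
have [t' le' it] := exec_leads e.
have [l' [z' [_ [u leu iu]]]] := sim_run hk (l := [::]) [::] it erefl.
have sz : size (layout (upd (fun=> [::]) 0 x) 0 k) = size x + k.
  by rewrite layout_init // size_cat size_map size_nseq.
exists u.
  apply: leq_trans (pb_poly_bound _ _ _); apply: leq_trans (Tb _); apply: leq_trans leu _.
  by rewrite sz; apply: leq_mul; rewrite ?leq_add2r ?leq_mul2l ?leq_add2l ?leq_mul2r /=; rewrite /T; lia.
have ext : blank_ext (tm_init M x) (tcfg (rstart R) (Home : phase k) [::] (layout (upd (fun=> [::]) 0 x) 0 k ++ [::])).
  rewrite layout_init // cats0; case: x {le iu leu sz s'0 e it} => [|b x] /=; last by exists k.
  have kn : nseq k (@None bool) = None :: nseq k.-1 None by case: (k) k0.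
  by exists k.-1; rewrite kn.
have := blank_ext_iter u ext; rewrite iu => ext'.
split; first by case: ext' => n [<- _] /=.
rewrite (blank_ext_output ext') /=.
(* The separator behind register 0 is where [read_out] stops. *)
rewrite -(prednK k0) /layout /= s'0 /block -cats1.
by case: (f _) => //= b w; congr cons; elim: w => //= a w ->.
Qed.


(** * Arithmetic and loops in polynomial time *)

(** Numbers are written in unary: such a function is polynomially bounded and may serve as the
    number of rounds of a loop. *)
Definition FN (n : seq str -> nat) := FP (fun e => nseq (n e) true).
Definition FB (p : seq str -> bool) := FP (fun e => [:: p e]).

Lemma FN_ext m n : FN m -> (forall e, m e = n e) -> FN n.
Proof. by move=> Fm mn; apply: FP_ext Fm _ => e; rewrite mn. Qed.

Lemma FB_ext p q : FB p -> (forall e, p e = q e) -> FB q.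
Proof. by move=> Fp pq; apply: FP_ext Fp _ => e; rewrite pq. Qed.

Lemma FN_size_bound n : FN n -> exists c k, forall e, n e <= pb c k (esize e).
Proof. by move=> /FP_size[c [k h]]; exists c, k => e; have := h e; rewrite size_nseq. Qed.

Lemma FP_srec_bound p u g h : polybd p -> FP u -> FP g -> FP (h false) -> FP (h true) ->
  (forall e w, size w <= size (u e) -> size (srec g h w e) <= p (esize e)) ->
  FP (fun e => srec g h (u e) e).
Proof.
move=> [c [k pP]] Fu Fg F0 F1 sz; apply: (@FP_srec u g h c k) => // e w le.
exact: leq_trans (sz e w le) (pP _).
Qed.

Lemma FP_drop2 f : FP f -> FP (fun e => f (behead (behead e))).
Proof. by move=> F; exact: (FP_behead (FP_behead F)). Qed.

(** Recursion over a string of one bit is a case distinction. The branches skip the two additional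
    arguments of the recursion. *)
Lemma FP_if p f g : FB p -> FP f -> FP g -> FP (fun e => if p e then f e else g e).
Proof.
move=> Fp Ff Fg; have [c1 [k1 h1]] := FP_size Ff; have [c2 [k2 h2]] := FP_size Fg.
pose h (b : bool) := fun e : seq str =>
  if b then f (behead (behead e)) else g (behead (behead e)).
have F : FP (fun e => srec (fun=> [::]) h [:: p e] e).
  apply: (@FP_srec_bound (fun n => pb c1 k1 n + pb c2 k2 n)); rewrite ?/h //.
  - by polybd.
  - exact: FP_nil.
  - exact: FP_drop2.
  - exact: FP_drop2.
  - move=> e [|b w] _ //; rewrite /h /=; case: b.
      exact: leq_trans (h1 e) (leq_addr _ _).
    exact: leq_trans (h2 e) (leq_addl _ _).
by apply: FP_ext F _ => e /=; rewrite /h.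
Qed.

Lemma FP_tail f : FP f -> FP (fun e => behead (f e)).
Proof.
move=> Ff; have [c [k hf]] := FP_size Ff.
pose h (b : bool) := fun e : seq str => nth [::] e 0.
have F : FP (fun e => srec (fun=> [::]) h (f e) e).
  apply: (@FP_srec_bound (pb c k)); rewrite ?/h //; [by polybd|exact: FP_nil|exact: FP_nth..|].
  by move=> e [|b w] le //=; apply: leq_trans (hf e); apply: leq_trans le; rewrite /= leqW.
by apply: FP_ext F _ => e; case: (f e).
Qed.

Lemma FB_head f : FP f -> FB (fun e => head false (f e)).
Proof.
move=> Ff; have F : FP (fun e => srec (fun=> [:: false]) (fun b _ => [:: b]) (f e) e).
  by apply: (@FP_srec_bound (fun=> 1)) => [||||| e []] //; [polybd|exact: FP_cst..].
by apply: FP_ext F _ => e; case: (f e).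
Qed.

Lemma FB_nilp f : FP f -> FB (fun e => nilp (f e)).
Proof.
move=> Ff; have F : FP (fun e => srec (fun=> [:: true]) (fun b _ => [:: false]) (f e) e).
  by apply: (@FP_srec_bound (fun=> 1)) => [||||| e []] //; [polybd|exact: FP_cst..].
by apply: FP_ext F _ => e; case: (f e).
Qed.

Lemma FP_cat f g : FP f -> FP g -> FP (fun e => f e ++ g e).
Proof.
move=> Ff Fg; have [c1 [k1 h1]] := FP_size Ff; have [c2 [k2 h2]] := FP_size Fg.
pose h (b : bool) := fun e : seq str => b :: nth [::] e 1.
have E w e : srec g h w e = w ++ g e by elim: w => //= b w ->.
have F : FP (fun e => srec g h (f e) e).
  apply: (@FP_srec_bound (fun n => pb c1 k1 n + pb c2 k2 n)); rewrite ?/h //.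
  - by polybd.
  - by apply: FP_cons; exact: FP_nth.
  - by apply: FP_cons; exact: FP_nth.
  - by move=> e w le; rewrite E size_cat leq_add // (leq_trans le).
by apply: FP_ext F _ => e; rewrite E.
Qed.

Lemma FN_size f : FP f -> FN (fun e => size (f e)).
Proof.
move=> Ff; have [c [k hf]] := FP_size Ff.
pose h (b : bool) := fun e : seq str => true :: nth [::] e 1.
have E w e : srec (fun=> [::]) h w e = nseq (size w) true by elim: w => //= b w ->.
have F : FP (fun e => srec (fun=> [::]) h (f e) e).
  apply: (@FP_srec_bound (pb c k)); rewrite ?/h //.
  - by polybd.
  - exact: FP_nil.
  - by apply: FP_cons; exact: FP_nth.
  - by apply: FP_cons; exact: FP_nth.
  - by move=> e w le; rewrite E size_nseq (leq_trans le).
by apply: FP_ext F _ => e; rewrite E.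
Qed.

Lemma FN_var i : FN (fun e => size (nth [::] e i)).
Proof. by apply: FN_size; apply: FP_nth. Qed.

Lemma FP_iter p n g G : polybd p -> FN n -> FP g ->
  FP (fun e => G (nth [::] e 0) (behead e)) ->
  (forall e i, i <= n e -> size (iter i (fun a => G a e) (g e)) <= p (esize e)) ->
  FP (fun e => iter (n e) (fun a => G a e) (g e)).
Proof.
move=> Pp Fn Fg FG sz.
pose h (b : bool) := fun e : seq str => G (nth [::] (behead e) 0) (behead (behead e)).
have E w e : srec g h w e = iter (size w) (fun a => G a e) (g e).
  by elim: w => //= b w; rewrite /h /= => ->.
have F : FP (fun e => srec g h (nseq (n e) true) e).
  apply: (@FP_srec_bound p); rewrite ?/h //; first exact: FP_behead FG.
    exact: FP_behead FG.
  by move=> e w; rewrite size_nseq => le; rewrite E sz.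
by apply: FP_ext F _ => e; rewrite E size_nseq.
Qed.

(** The loop index is the length of the part of the counter already treated. As [G] does not see the
    output so far, the number of rounds times the bound for one piece bounds the output. *)
Lemma FP_flatten n G : FN n -> FP (fun e => G (size (nth [::] e 0)) (behead e)) ->
  FP (fun e => flatten [seq G i e | i <- iota 0 (n e)]).
Proof.
move=> Fn FG; have [c1 [k1 h1]] := FN_size_bound Fn; have [c2 [k2 h2]] := FP_size FG.
pose h (b : bool) := fun e : seq str =>
  nth [::] e 1 ++ G (size (nth [::] e 0)) (behead (behead e)).
have E w e : srec (fun=> [::]) h w e = flatten [seq G i e | i <- iota 0 (size w)].
  elim: w => // b w IH; rewrite [LHS]/= IH [size (b :: w)]/= -addn1 iotaD map_cat.
  by rewrite flatten_cat /= cats0.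
have Fh b : FP (h b).
  apply: FP_cat; first exact: FP_nth.
  by have F := @FP_take_drop 1 2 _ isT FG; apply: FP_ext F _ => -[|x [|y e]] //=; rewrite drop0.
have F : FP (fun e => srec (fun=> [::]) h (nseq (n e) true) e).
  apply: (@FP_srec_bound (fun m => pb c1 k1 m * pb c2 k2 (pb c1 k1 m + m))) => //.
  - by polybd.
  - exact: FP_nil.
  - move=> e w; rewrite size_nseq => le; rewrite E.
    apply: (@leq_trans (size w * pb c2 k2 (pb c1 k1 (esize e) + esize e))).
      rewrite -[in X in _ <= X](size_iota 0 (size w)).
      have : {subset iota 0 (size w) <= iota 0 (n e)} by move=> i; rewrite !mem_iota; lia.
      elim: (iota 0 _) => //= i r IH sub; rewrite size_cat mulSn leq_add //; last first.
        by apply: IH => j jr; apply: sub; rewrite inE jr orbT.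
      have := h2 (nseq i true :: e); rewrite /= size_nseq => le1; apply: leq_trans le1 _.
      apply: pb_mono; rewrite /esize /= size_nseq leq_add2r (leq_trans _ (h1 e)) //.
      by have := sub i (mem_head _ _); rewrite mem_iota; lia.
    by rewrite leq_mul2r (leq_trans le) ?h1 ?orbT.
by apply: FP_ext F _ => e; rewrite E size_nseq.
Qed.

Lemma FP_app1 (F : str -> str) f :
  FP (fun e => F (nth [::] e 0)) -> FP f -> FP (fun e => F (f e)).
Proof. by move=> FF Ff; have := FP_let Ff FF. Qed.

Lemma FN_cst n : FN (fun=> n).
Proof. exact: FP_cst. Qed.

Lemma FB_cst b : FB (fun=> b).
Proof. exact: FP_cst. Qed.

Lemma FN_behead n : FN n -> FN (fun e => n (behead e)).
Proof. exact: FP_behead. Qed.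

Lemma FN_if p m n : FB p -> FN m -> FN n -> FN (fun e => if p e then m e else n e).
Proof. by move=> Fp Fm Fn; apply: FP_ext (FP_if Fp Fm Fn) _ => e; case: ifP. Qed.

Lemma FB_if p q r : FB p -> FB q -> FB r -> FB (fun e => if p e then q e else r e).
Proof. by move=> Fp Fm Fn; apply: FP_ext (FP_if Fp Fm Fn) _ => e; case: ifP. Qed.

Lemma FB_and p q : FB p -> FB q -> FB (fun e => p e && q e).
Proof. by move=> Fp Fq; apply: FB_ext (FB_if Fp Fq (FB_cst false)) _ => e; case: (p e). Qed.

Lemma FB_or p q : FB p -> FB q -> FB (fun e => p e || q e).
Proof. by move=> Fp Fq; apply: FB_ext (FB_if Fp (FB_cst true) Fq) _ => e; case: (p e). Qed.

Lemma FB_not p : FB p -> FB (fun e => ~~ p e).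
Proof. by move=> Fp; apply: FB_ext (FB_if Fp (FB_cst false) (FB_cst true)) _ => e; case: (p e). Qed.

Lemma FB_imply p q : FB p -> FB q -> FB (fun e => p e ==> q e).
Proof. by move=> Fp Fq; apply: FB_ext (FB_if Fp Fq (FB_cst true)) _ => e; case: (p e). Qed.

Lemma FN_add m n : FN m -> FN n -> FN (fun e => m e + n e).
Proof. by move=> Fm Fn; apply: FP_ext (FP_cat Fm Fn) _ => e; rewrite nseqD. Qed.

Lemma FN_S n : FN n -> FN (fun e => (n e).+1).
Proof. exact: FP_cons. Qed.

Lemma FN_mul m n : FN m -> FN n -> FN (fun e => m e * n e).
Proof.
move=> Fm Fn; apply: FP_ext (FP_flatten Fm (G := fun _ e => nseq (n e) true) (FN_behead Fn)) _.
move=> e; rewrite -[in RHS](size_iota 0 (m e)); elim: (iota 0 _) => //= i r ->.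
by rewrite mulSn nseqD.
Qed.

Lemma FN_exp n k : FN n -> FN (fun e => n e ^ k).
Proof.
move=> Fn; elim: k => [|k IH]; first exact: FN_cst.
by apply: FN_ext (FN_mul Fn IH) _ => e; rewrite expnS.
Qed.

Lemma FP_drop n f : FN n -> FP f -> FP (fun e => drop (n e) (f e)).
Proof.
move=> Fn Ff; have [c [k hf]] := FP_size Ff.
have E i w : iter i behead w = drop i w :> str.
  by elim: i => [|i IH] /=; rewrite ?drop0 // IH -drop1 drop_drop.
have F : FP (fun e => iter (n e) (fun a => behead a) (f e)).
  apply: (@FP_iter (pb c k)) => //; first by polybd.
    by apply: FP_tail; apply: FP_nth.
  by move=> e i _; rewrite E size_drop (leq_trans (leq_subr _ _)).
by apply: FP_ext F _ => e; rewrite E.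
Qed.

Lemma FN_sub m n : FN m -> FN n -> FN (fun e => m e - n e).
Proof.
move=> Fm Fn; apply: FP_ext (FP_drop Fn Fm) _ => e.
by apply: (@eq_from_nth _ true) => [|i]; rewrite size_drop !size_nseq // => lt;
  rewrite nth_drop !nth_nseq; do 2!case: ifP.
Qed.

Lemma FB_leq m n : FN m -> FN n -> FB (fun e => m e <= n e).
Proof.
move=> Fm Fn; apply: FB_ext (FB_nilp (FN_sub Fm Fn)) _ => e.
by rewrite /nilp size_nseq subn_eq0.
Qed.

Lemma FB_ltn m n : FN m -> FN n -> FB (fun e => m e < n e).
Proof. by move=> Fm; apply: FB_leq; apply: FN_S. Qed.

Lemma FB_eqn m n : FN m -> FN n -> FB (fun e => m e == n e).
Proof.
move=> Fm Fn; apply: FB_ext (FB_and (FB_leq Fm Fn) (FB_leq Fn Fm)) _ => e.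
by rewrite eqn_leq.
Qed.

Lemma FB_nth f n : FP f -> FN n -> FB (fun e => nth false (f e) (n e)).
Proof.
move=> Ff Fn; apply: FB_ext (FB_head (FP_drop Fn Ff)) _ => e.
by rewrite -nth0 nth_drop addn0.
Qed.

Lemma FB_all n P : FN n -> FB (fun e => P (size (nth [::] e 0)) (behead e)) ->
  FB (fun e => all (fun i => P i e) (iota 0 (n e))).
Proof.
move=> Fn FP'.
have F := FP_flatten Fn (G := fun i e => if P i e then [::] else [:: true])
  (FP_if FP' FP_nil (FP_cst [:: true])).
apply: FB_ext (FB_nilp F) _ => e; elim: (iota _ _) => //= i r <-.
by case: (P i e).
Qed.

Lemma FN_count n P : FN n -> FB (fun e => P (size (nth [::] e 0)) (behead e)) ->
  FN (fun e => count (fun i => P i e) (iota 0 (n e))).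
Proof.
move=> Fn FP'.
have F := FP_flatten Fn (G := fun i e => if P i e then [:: true] else [::])
  (FP_if FP' (FP_cst [:: true]) FP_nil).
apply: FN_ext (FN_size F) _ => e; elim: (iota _ _) => //= i r <-.
by rewrite size_cat; case: (P i e).
Qed.

(** The quotient counts the positive multiples of the divisor up to the dividend; the test [0 < n e]
    reproduces the value 0 of a division by 0. *)
Lemma FN_div m n : FN m -> FN n -> FN (fun e => m e %/ n e).
Proof.
move=> Fm Fn.
have F : FN (fun e => count (fun i => (0 < n e) && (i.+1 * n e <= m e)) (iota 0 (m e))).
  apply: FN_count => //; apply: FB_and; first by apply: FB_ltn; [exact: FN_cst|exact: FN_behead].
  apply: FB_leq; last exact: FN_behead.
  by apply: FN_mul; [apply: FN_S; exact: FN_var|exact: FN_behead].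
apply: FN_ext F _ => e; case: (posnP (n e)) => [->|n0] /=.
  by rewrite divn0; elim: (iota _ _).
under eq_count => i do rewrite -leq_divRL //.
have : m e %/ n e <= m e by apply: leq_div.
move: (m e) => a le; rewrite -size_filter.
have -> : [seq i <- iota 0 a | i < a %/ n e] = iota 0 (a %/ n e).
  rewrite -[in iota 0 a](subnKC (leq_div a (n e))) iotaD filter_cat add0n.
  rewrite (_ : filter _ _ = iota 0 (a %/ n e)); last first.
    by apply/all_filterP/allP => i; rewrite mem_iota.
  rewrite (_ : filter _ _ = [::]) ?cats0 //; apply/eqP.
  by rewrite -size_eq0 size_filter -leqn0 leqNgt -has_count; apply/hasPn => i; rewrite mem_iota; lia.
exact: size_iota.
Qed.

Lemma FN_mod m n : FN m -> FN n -> FN (fun e => m e %% n e).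
Proof.
move=> Fm Fn; apply: FN_ext (FN_sub Fm (FN_mul (FN_div Fm Fn) Fn)) _ => e.
by rewrite {1}(divn_eq (m e) (n e)) addKn.
Qed.

Lemma FN_poly_bound c k n : FN n -> FN (fun e => poly_bound c k (n e)).
Proof.
move=> Fn; apply: FN_add (FN_cst c); apply: FN_mul (FN_cst c) _; exact: FN_exp.
Qed.

(** Every [i < N] may have a program of its own. In this way elements of finite types become
    constants of the program. *)
Lemma FP_case_lt N n G : FN n -> (forall i, i < N -> FP (G i)) ->
  FP (fun e => if n e < N then G (n e) e else [::]).
Proof.
move=> Fn; elim: N => [|N IH] FG; first exact: FP_nil.
have F := FP_if (FB_eqn Fn (FN_cst N)) (FG N (ltnSn N)) (IH (fun i lt => FG i (ltnW lt))).
apply: FP_ext F _ => e; case: eqP => [->|/eqP/negPf ne]; first by rewrite ltnSn.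
by rewrite ltnS [n e <= N]leq_eqVlt ne.
Qed.

Lemma FP_case N n G : FN n -> (forall e, n e < N) -> (forall i, i < N -> FP (G i)) ->
  FP (fun e => G (n e) e).
Proof. by move=> Fn lt FG; apply: FP_ext (FP_case_lt Fn FG) _ => e; rewrite lt. Qed.

Lemma FB_case N n P : FN n -> (forall e, n e < N) -> (forall i, i < N -> FB (P i)) ->
  FB (fun e => P (n e) e).
Proof. by move=> Fn lt; apply: (FP_case (G := fun i e => [:: P i e]) Fn lt). Qed.

Lemma FP_enc_nat n : FN n -> FP (fun e => enc_nat (n e)).
Proof. by move=> Fn; apply: FP_cat Fn (FP_cst _). Qed.

(** * Simulation of Turing machines in polynomial time *)

Lemma FP_rev f : FP f -> FP (fun e => rev (f e)).
Proof.
move=> Ff; have [c [k hf]] := FP_size Ff.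
pose h (b : bool) := fun e : seq str => nth [::] e 1 ++ [:: b].
have E w e : srec (fun=> [::]) h w e = rev w.
  by elim: w => //= b w ->; rewrite rev_cons -cats1.
have F : FP (fun e => srec (fun=> [::]) h (f e) e).
  apply: (@FP_srec_bound (pb c k)); rewrite ?/h //.
  - by polybd.
  - exact: FP_nil.
  - by apply: FP_cat (FP_nth 1) (FP_cst _).
  - by apply: FP_cat (FP_nth 1) (FP_cst _).
  - by move=> e w le; rewrite E size_rev (leq_trans le).
by apply: FP_ext F _ => e; rewrite E.
Qed.

Lemma FP_take n f : FN n -> FP f -> FP (fun e => take (n e) (f e)).
Proof.
move=> Fn Ff.
apply: FP_ext (FP_rev (FP_drop (FN_sub (FN_size Ff) Fn) (FP_rev Ff))) _ => e.
rewrite drop_rev revK; case: (leqP (n e) (size (f e))) => le; first by rewrite subKn.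
by rewrite (eqP (ltnW le : _ - _ == 0)) subn0 take_size take_oversize // ltnW.
Qed.

Lemma FN_index f : FP f -> FN (fun e => index false (f e)).
Proof.
move=> Ff; have [c [k hf]] := FP_size Ff.
pose h (b : bool) := fun e : seq str => if b then true :: nth [::] e 1 else [::].
have E w e : srec (fun=> [::]) h w e = nseq (index false w) true.
  by elim: w => //= -[] w -> //=.
have F : FP (fun e => srec (fun=> [::]) h (f e) e).
  apply: (@FP_srec_bound (pb c k)); rewrite ?/h //.
  - by polybd.
  - exact: FP_nil.
  - exact: FP_nil.
  - by apply: FP_cons; apply: FP_nth.
  - move=> e w le; rewrite E size_nseq (leq_trans _ (hf e)) // (leq_trans _ le) //.
    exact: index_size.
by apply: FP_ext F _ => e; rewrite E.
Qed.

Definition pack (u v : str) : str := enc_nat (size u) ++ u ++ v.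
Definition unpack1 (w : str) : str := take (index false w) (drop (index false w).+1 w).
Definition unpack2 (w : str) : str := drop (index false w) (drop (index false w).+1 w).

Lemma index_enc_nat n w : index false (enc_nat n ++ w) = n.
Proof. by rewrite /enc_nat -catA; elim: n => //= n ->. Qed.

Lemma drop_enc_nat n w : drop n.+1 (enc_nat n ++ w) = w.
Proof. by rewrite drop_size_cat // /enc_nat size_cat size_nseq addn1. Qed.

Lemma packK1 u v : unpack1 (pack u v) = u.
Proof. by rewrite /unpack1 /pack index_enc_nat drop_enc_nat take_size_cat. Qed.

Lemma packK2 u v : unpack2 (pack u v) = v.
Proof. by rewrite /unpack2 /pack index_enc_nat drop_enc_nat drop_size_cat. Qed.

Lemma FP_pack f g : FP f -> FP g -> FP (fun e => pack (f e) (g e)).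
Proof. by move=> Ff Fg; apply: FP_cat; [exact: FP_enc_nat (FN_size Ff)|exact: FP_cat]. Qed.

Lemma FP_unpack1 f : FP f -> FP (fun e => unpack1 (f e)).
Proof.
move=> Ff; apply: FP_take; first exact: FN_index.
by apply: FP_drop => //; apply: FN_S; apply: FN_index.
Qed.

Lemma FP_unpack2 f : FP f -> FP (fun e => unpack2 (f e)).
Proof.
move=> Ff; apply: FP_drop; first exact: FN_index.
by apply: FP_drop => //; apply: FN_S; apply: FN_index.
Qed.

(** The code of the blank is such that reading beyond the end of an encoded tape, with default
    [false], gives blanks. *)
Definition enc_sym (a : option bool) : str :=
  if a is Some b then [:: true; b] else [:: false; false].
Definition enc_tape (s : seq (option bool)) : str := flatten (map enc_sym s).
Definition sym_code (a : option bool) : nat := if a is Some b then b.+1 else 0.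
Definition code_sym (i : nat) : option bool := nth None [:: None; Some false; Some true] i.
Definition head_code (w : str) : nat :=
  if head false w then (if nth false w 1 then 2 else 1) else 0.

Lemma size_enc_tape s : size (enc_tape s) = 2 * size s.
Proof. by elim: s => //= a s IH; rewrite size_cat IH; case: a => [b|] /=; lia. Qed.

Lemma FN_head_code f : FP f -> FN (fun e => head_code (f e)).
Proof.
move=> Ff; apply: FN_if (FB_head Ff) _ (FN_cst 0).
exact: FN_if (FB_nth Ff (FN_cst 1)) (FN_cst 2) (FN_cst 1).
Qed.

Section TMsim.
Variable M : TM.

Definition enc_config (c : config M) : str :=
  let: (q, (l, h, r)) := c in
  pack (nseq (enum_rank q) true) (pack (enc_tape l) (enc_tape (h :: r))).

(** State and symbol are fixed here, so that the transition table is consulted when the program is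
    built and not when it is run. *)
Definition step_case (i a : nat) (l r : str) : str :=
  let q := nth (tm_start M) (enum (tm_state M)) i in
  if tm_halt M q then pack (nseq i true) (pack l r) else
  let: (q', w, mv) := tm_delta M q (code_sym a) in
  let q1 : str := nseq (enum_rank q') true in
  match mv with
  | Stay => pack q1 (pack l (enc_sym w ++ drop 2 r))
  | MoveR => pack q1 (pack (enc_sym w ++ l)
      (if nilp (drop 2 r) then enc_sym None else drop 2 r))
  | MoveL => pack q1 (pack (drop 2 l)
      ((if nilp l then enc_sym None else take 2 l) ++ enc_sym w ++ drop 2 r))
  end.

Definition step_str (w : str) : str :=
  let i := size (unpack1 w) in let l := unpack1 (unpack2 w) in
  let r := unpack2 (unpack2 w) in
  if i < #|tm_state M| then
    if head_code r < 3 then step_case i (head_code r) l r else [::]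
  else [::].

Lemma step_strE c : step_str (enc_config c) = enc_config (tm_step M c).
Proof.
case: c => q [[l h] r]; rewrite /step_str /enc_config !packK1 !packK2 size_nseq ltn_ord.
have -> : head_code (enc_tape (h :: r)) = sym_code h by case: h => [[]|].
have -> : sym_code h < 3 by case: h => [[]|].
rewrite /step_case; have -> : nth (tm_start M) (enum (tm_state M)) (enum_rank q) = q.
  exact: nth_enum_rank.
have -> : code_sym (sym_code h) = h by case: h => [[]|].
have -> : drop 2 (enc_tape (h :: r)) = enc_tape r by case: h => [b|] /=; rewrite drop0.
rewrite /tm_step packK1; case: ifP => _ //.
case: (tm_delta M _ _) => [[q' w] []].
- case: l => [|a l] //=; rewrite ?drop0.
  have -> : nilp (enc_tape (a :: l)) = false by case: a.
  by congr (pack _ (pack _ _)); case: a => [b|]; rewrite /= ?drop0 ?take0.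
- by case: r => [|a r] //=; case: a.
- by [].
Qed.

Lemma iter_step_str i c : iter i step_str (enc_config c) = enc_config (iter i (tm_step M) c).
Proof. by elim: i => //= i ->; rewrite step_strE. Qed.

Lemma tm_iter_size i (c : config M) : let d := iter i (tm_step M) c in
  size d.2.1.1 <= size c.2.1.1 + i /\ size d.2.2 <= size c.2.2 + i.
Proof.
elim: i => [|i] /=; first by rewrite !addn0.
case: (iter i _ c) => q [[l h] r] /= [lel ler]; case: ifP => _ /=; first by lia.
case: (tm_delta M _ _) => [[q' w] []] /=.
- by case: l lel => [|a l] /=; lia.
- by case: r ler => [|a r] /=; lia.
- by lia.
Qed.

Lemma FP_step_str f : FP f -> FP (fun e => step_str (f e)).
Proof.
move=> Ff.
have F1 := FP_unpack1 Ff; have F2 := FP_unpack2 Ff.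
have Fl := FP_unpack1 F2; have Fr := FP_unpack2 F2.
apply: (@FP_case_lt #|tm_state M| (fun e => size (unpack1 (f e)))
  (fun i e => if head_code (unpack2 (unpack2 (f e))) < 3 then
     step_case i (head_code (unpack2 (unpack2 (f e)))) (unpack1 (unpack2 (f e)))
       (unpack2 (unpack2 (f e))) else [::]) (FN_size F1)) => i _.
apply: (@FP_case_lt 3 (fun e => head_code (unpack2 (unpack2 (f e))))
  (fun a e => step_case i a (unpack1 (unpack2 (f e))) (unpack2 (unpack2 (f e))))
  (FN_head_code Fr)) => a _.
rewrite /step_case; case: (tm_halt M _).
  exact: FP_pack (FP_cst _) (FP_pack Fl Fr).
have D2 g : FP g -> FP (fun e => drop 2 (g e)) by move=> Fg; apply: FP_drop (FN_cst 2) Fg.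
case: (tm_delta M _ _) => [[q' w] []]; apply: FP_pack (FP_cst _) _; apply: FP_pack.
- exact: D2.
- apply: FP_cat; last by apply: FP_cat; [exact: FP_cst|exact: D2].
  apply: FP_if; [exact: FB_nilp|exact: FP_cst|].
  exact: FP_take (FN_cst 2) Fl.
- by apply: FP_cat => //; exact: FP_cst.
- by apply: FP_if; [apply: FB_nilp; exact: D2|exact: FP_cst|exact: D2].
- by [].
- by apply: FP_cat; [exact: FP_cst|exact: D2].
Qed.

Lemma FP_tm_init f : FP f -> FP (fun e => enc_config (tm_init M (f e))).
Proof.
move=> Ff.
have Ft : FP (fun e => enc_tape (map Some (f e))).
  apply: (@FP_app1 (fun w => enc_tape (map Some w))) Ff.
  have E w e : srec (fun=> [::]) (fun b e => [:: true, b & nth [::] e 1]) w e = enc_tape (map Some w).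
    by elim: w => //= b w ->.
  have F : FP (fun e => srec (fun=> [::]) (fun b e => [:: true, b & nth [::] e 1]) (nth [::] e 0) e).
    apply: (@FP_srec_bound (fun n => 2 * n)); rewrite //.
    - by polybd.
    - exact: FP_nth.
    - exact: FP_nil.
    - by do 2!apply: FP_cons; exact: FP_nth.
    - by do 2!apply: FP_cons; exact: FP_nth.
    - move=> e w le; rewrite E size_enc_tape size_map leq_mul2l (leq_trans le) //.
      exact: esize_nth.
  by apply: FP_ext F _ => e; rewrite E.
have F : FP (fun e => pack (nseq (enum_rank (tm_start M)) true)
    (pack [::] (if nilp (f e) then enc_sym None else enc_tape (map Some (f e))))).
  apply: FP_pack (FP_cst _) _; apply: FP_pack (FP_cst _) _.
  by apply: FP_if => //; [exact: FB_nilp|exact: FP_cst].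
by apply: FP_ext F _ => e; case: (f e).
Qed.

Lemma FP_tm_iter f n : FP f -> FN n ->
  FP (fun e => enc_config (iter (n e) (tm_step M) (tm_init M (f e)))).
Proof.
move=> Ff Fn; have [c [k hf]] := FP_size Ff; have [c' [k' hn]] := FN_size_bound Fn.
have [N hN] : exists N, forall q : tm_state M, enum_rank q < N.
  by exists #|tm_state M| => q; apply: ltn_ord.
pose p m := 4 * N + 20 + 4 * (pb c k m + 2 * pb c' k' m).
have F : FP (fun e => iter (n e) (fun a => step_str a) (enc_config (tm_init M (f e)))).
  apply: (@FP_iter p) => //; first by rewrite /p; polybd.
  - exact: FP_tm_init.
  - by apply: FP_step_str; exact: FP_nth.
  - move=> e i le; rewrite iter_step_str.
    have := tm_iter_size i (tm_init M (f e)); set d := iter _ _ _.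
    have [s1 s2] : size (tm_init M (f e)).2.1.1 = 0 /\ size (tm_init M (f e)).2.2 <= size (f e).
      by case: (f e) => //= b w; rewrite size_map.
    rewrite s1; case: d => q [[l h] r] /= [sl sr].
    rewrite /enc_config /pack /enc_nat ?(size_cat, size_nseq, size_enc_tape).
    by have := hN q; have := hf e; have := hn e; rewrite /p /=; lia.
by apply: FP_ext F _ => e; rewrite iter_step_str.
Qed.

(** A loop without memory: a cell is output iff no blank occurs up to it. For an encoded tape
    [size w] is twice the number of cells, but cells beyond the end read as blanks. *)
Definition read_str (w : str) : str :=
  flatten [seq if all (fun j => nth false w (2 * j)) (iota 0 i.+1)
    then [:: nth false w (2 * i).+1] else [::] | i <- iota 0 (size w)].

Lemma iota1 n : iota 1 n = map S (iota 0 n).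
Proof. by rewrite (iotaDl 1 0). Qed.

Lemma read_strE s : read_str (enc_tape s) = read_out s.
Proof.
have E n : size s <= n -> flatten [seq if all (fun j => nth false (enc_tape s) (2 * j)) (iota 0 i.+1)
    then [:: nth false (enc_tape s) (2 * i).+1] else [::] | i <- iota 0 n] = read_out s.
  elim: s n => [|a s IH] n le.
    by rewrite /enc_tape /=; elim: (iota 0 n) => //= i r ->; rewrite nth_nil.
  case: n le => // n; rewrite [size _ <= _]ltnS => le.
  have nS j : nth false (enc_tape (a :: s)) (2 * j.+1) = nth false (enc_tape s) (2 * j).
    by rewrite mulnS; case: (a).
  have nS' j : nth false (enc_tape (a :: s)) (2 * j.+1).+1 = nth false (enc_tape s) (2 * j).+1.
    by rewrite mulnS; case: (a).
  rewrite [iota 0 n.+1]/= iota1 map_cons -map_comp [flatten _]/=.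
  rewrite (eq_map (g := fun i => if nth false (enc_tape (a :: s)) 0 &&
     all (fun j => nth false (enc_tape s) (2 * j)) (iota 0 i.+1)
     then [:: nth false (enc_tape s) (2 * i).+1] else [::])); last first.
    move=> i; rewrite -[LHS]/(if nth false (enc_tape (a :: s)) (2 * 0) &&
      all (fun j => nth false (enc_tape (a :: s)) (2 * j)) (iota 1 i.+1)
      then [:: nth false (enc_tape (a :: s)) (2 * i.+1).+1] else [::]) iota1 nS' all_map.
    by rewrite muln0 (eq_all (a2 := fun j => nth false (enc_tape s) (2 * j))).
  clear nS nS'; case: a => [b|] /=; last by elim: (iota 0 n).
  by rewrite -(IH n le).
by apply: E; rewrite size_enc_tape; lia.
Qed.

Lemma FP_tm_output f n : FP f -> FN n ->
  FP (fun e => tm_output M (iter (n e) (tm_step M) (tm_init M (f e)))).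
Proof.
move=> Ff Fn.
have F : FP (fun e => read_str (nth [::] e 0)).
  apply: (@FP_flatten (fun e => size (nth [::] e 0)) (fun i e =>
    if all (fun j => nth false (nth [::] e 0) (2 * j)) (iota 0 i.+1)
    then [:: nth false (nth [::] e 0) (2 * i).+1] else [::])); first exact: FN_var.
  have Fw : FP (fun e => nth [::] (behead e) 0) by exact: (FP_behead (FP_nth 0)).
  apply: FP_if; last exact: FP_nil.
    apply: (@FB_all (fun e => (size (nth [::] e 0)).+1)
      (fun j e => nth false (nth [::] (behead e) 0) (2 * j))).
      by apply: FN_S; exact: FN_var.
    apply: FB_nth; first exact: (FP_behead Fw).
    by apply: FN_mul; [exact: FN_cst|exact: FN_var].
  by apply: FB_nth => //; apply: FN_S; apply: FN_mul; [exact: FN_cst|exact: FN_var].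
have Fi := FP_unpack2 (FP_unpack2 (FP_tm_iter Ff Fn)).
apply: FP_ext (FP_app1 F Fi) _ => e.
by case: (iter _ _ _) => q [[l h] r] /=; rewrite !packK2 read_strE.
Qed.
End TMsim.


(** * Positions and satisfactions *)

Section Ranks.
Variables (T : finType) (x0 : T).

Definition frank (x : T) : nat := index x (enum T).

Lemma frank_lt x : frank x < #|T|.
Proof. by rewrite cardE index_mem mem_enum. Qed.

Lemma frankK x : nth x0 (enum T) (frank x) = x.
Proof. by rewrite nth_index ?mem_enum. Qed.

Lemma nth_frank i : i < #|T| -> frank (nth x0 (enum T) i) = i.
Proof. by move=> lt; rewrite /frank index_uniq -?cardE // enum_uniq. Qed.
End Ranks.

Lemma card_ord_geq n k : #|[set i : 'I_n | k <= i]| = n - k.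
Proof.
rewrite -sum1_card -[RHS]muln1 -sum_nat_const_nat (big_geq_mkord _ _ xpredT).
by apply: eq_bigl => i; rewrite inE.
Qed.

Lemma card_fibers n m c (Phi : 'I_n -> 'I_m) (X : {set 'I_n}) :
  (forall a, #|[set i | Phi i == a]| <= c) -> #|X| <= c * #|Phi @: X|.
Proof.
move=> fib; rewrite -sum1_card (partition_big_imset Phi) /= mulnC -sum_nat_const.
apply: leq_sum => a _; rewrite sum1_card; apply: leq_trans (fib a); apply: subset_leq_card.
by apply/subsetP => i; rewrite !inE => /andP[].
Qed.

Section DPSF.
Variable alpha : nat -> nat -> nat.
Hypothesis normal : normal_DPSF alpha.

Lemma alpha_anti m i j : 1 <= i -> i <= j -> j <= m -> alpha m j <= alpha m i.
Proof.
case: normal => dec _ _ _ i1; rewrite leq_eqVlt => /orP[/eqP-> //|ij jm].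
by apply: ltnW; apply: dec.
Qed.

(** A strictly decreasing function with natural values gains at least one with every step up from
    the last position. *)
Lemma alpha_lower m i : 1 <= i -> i <= m -> m - i <= alpha m i.
Proof.
case: normal => dec _ _ _ i1 im.
have: forall d, d <= m - i -> d <= alpha m (m - d).
  elim=> // d IH le; apply: (@leq_ltn_trans (alpha m (m - d))); first by apply: IH; lia.
  by apply: dec; lia.
by move/(_ (m - i) (leqnn _)); rewrite subKn.
Qed.

(** Normality iterated: a value depends only on the number of alternatives ranked below, so that
    additional positions on top leave the lower values unchanged. *)
Lemma alpha_shift m i t : 1 <= i <= m -> alpha (m + t) (i + t) = alpha m i.
Proof.
case: normal => _ _ sh _ im; elim: t => [|t IH]; first by rewrite !addn0.
by rewrite !addnS sh ?IH //; lia.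
Qed.
End DPSF.

(** * Profiles given by lists of alternatives *)

Section ListProfile.
Variables (n m : nat) (ord : nat -> seq nat).
Hypothesis ordP : forall i, perm_eq (ord i) (iota 0 m).

Lemma ord_nth_lt i (j : 'I_m) : nth 0 (ord i) j < m.
Proof.
have : nth 0 (ord i) j \in ord i by rewrite mem_nth // (perm_size (ordP i)) size_iota.
by rewrite (perm_mem (ordP i)) mem_iota.
Qed.

Lemma ord_inj i : injective (fun j => Ordinal (ord_nth_lt i j)).
Proof.
move=> j1 j2 /(congr1 val) /= /eqP.
rewrite nth_uniq ?(perm_size (ordP i)) ?size_iota // ?(perm_uniq (ordP i)) ?iota_uniq //.
by move=> /eqP /val_inj.
Qed.

Definition list_profile (i : 'I_n) : {perm 'I_m} := perm (@ord_inj i).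

Lemma pos_list_profile i a : pos n m list_profile i a = (index (val a) (ord i)).+1.
Proof.
rewrite /pos; congr _.+1; pose j := ((list_profile i)^-1)%g a.
rewrite -/j.
have {1}-> : a = list_profile i j by rewrite /j permKV.
rewrite permE /= index_uniq // ?(perm_size (ordP i)) ?size_iota //.
by rewrite (perm_uniq (ordP i)) iota_uniq.
Qed.

Lemma enc_list_profile K : enc_instance n m K list_profile =
  enc_nat n ++ enc_nat m ++ enc_nat K ++
  flatten [seq flatten [seq enc_nat a | a <- ord i] | i <- iota 0 n].
Proof.
rewrite /enc_instance; do 3!congr (_ ++ _); congr flatten.
rewrite -(val_enum_ord n) -map_comp; apply: eq_map => i /=; congr flatten.
have -> : [seq enc_nat (list_profile i j) | j <- enum 'I_m]
   = [seq enc_nat (nth 0 (ord i) j) | j <- map val (enum 'I_m)].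
  by rewrite -map_comp; apply: eq_map => j; rewrite permE.
rewrite val_enum_ord (map_comp enc_nat (nth 0 (ord i))); congr map.
have sz : size (ord i) = m by rewrite (perm_size (ordP i)) size_iota.
by rewrite -sz map_nth_iota0 // take_size.
Qed.
End ListProfile.

Section ClassOrder.
Variables (m : nat) (cls : nat -> nat).

(** Three tiers: the alternatives liked, those in between and those disliked. The order within a
    tier is irrelevant to the argument. *)
Definition class_order : seq nat :=
  [seq a <- iota 0 m | cls a == 0] ++ [seq a <- iota 0 m | cls a == 1] ++
  [seq a <- iota 0 m | cls a == 2].

Hypothesis cls3 : forall a, cls a < 3.

Lemma class_order_perm : perm_eq class_order (iota 0 m).
Proof.
rewrite /class_order; apply: perm_trans (permEl (perm_filterC (fun a => cls a == 0) _)).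
rewrite perm_cat2l; set s := filter (predC _) _.
apply: perm_trans (permEl (perm_filterC (fun a => cls a == 1) s)).
rewrite -!filter_predI.
rewrite (eq_filter (a2 := predI (fun a => cls a == 1) (predC (fun a => cls a == 0)))); last first.
  by move=> a /=; case: (cls a) => [|[]].
rewrite perm_cat2l (eq_filter (a2 := predI (predC (fun a => cls a == 1)) (predC (fun a => cls a == 0)))) //.
by move=> a /=; case: (cls a) (cls3 a) => [|[|[]]].
Qed.

Lemma index_class0 a : a < m -> cls a = 0 ->
  index a class_order < count (fun a => cls a == 0) (iota 0 m).
Proof.
move=> am ca; rewrite /class_order index_cat mem_filter ca eqxx mem_iota am /=.
by rewrite -size_filter index_mem mem_filter ca mem_iota am.
Qed.

Lemma index_class2 a : a < m -> cls a = 2 ->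
  count (fun a => cls a != 2) (iota 0 m) <= index a class_order.
Proof.
move=> am ca; rewrite /class_order catA index_cat mem_cat !mem_filter ca /=.
apply: leq_trans (leq_addr _ _); rewrite size_cat !size_filter.
elim: (iota 0 m) => //= b r; case: (cls b) (cls3 b) => [|[|[]]] //=; lia.
Qed.
End ClassOrder.

(** * From constraint satisfaction to Monroe assignments *)

Section Reduction.
Variables (D C : finType) (d0 : D) (V mp : nat) (sh : bool -> nat).
Variables (ok : nat -> D -> bool) (lc rc : bool -> D -> C).
Hypotheses (V0 : 0 < V) (sh_le : forall i, sh i <= V).

(** Neighbours are cyclic translations, hence each variable is the neighbour of exactly one variable
    in each direction. This keeps the number of agents served by one value within the capacity. *)
Definition nb (i : bool) (v : nat) : nat := (v + sh i) %% V.

Definition csp_sol (f : nat -> D) : Prop := forall v, v < V ->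
  ok v (f v) /\ forall i, lc i (f v) = rc i (f (nb i v)).

(* A slot [None] of a variable asks for a value of this variable; the slots
   [Some (i, h)] make [d] at [v] and [d'] at [nb i v] compatible iff they serve
   disjoint sets of colours [h], that is, iff [lc i d = rc i d']. *)
Notation slot := (option (bool * C)).
Definition cap : nat := #|{: slot}|.
Definition nvals : nat := #|D|.
Definition nalt1 : nat := V * nvals.
(** The number [K]: one winner for every variable and every dummy. With a group of [cap] agents for
    each of them, [n / K] is [cap]. *)
Definition nwin : nat := V + mp.
Definition nag : nat := cap * nwin.
Definition nalt : nat := nalt1 + mp.

Definition likes (v : nat) (s : slot) (v' : nat) (d : D) : bool :=
  ok v' d && match s with
    | None => v' == v
    | Some (i, h) => (v' == v) && (lc i d == h) || (v' == nb i v) && (rc i d != h)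
    end.

Definition slot_of (x : nat) : slot := nth None (enum {: slot}) x.
Definition val_of (x : nat) : D := nth d0 (enum D) x.

(** For an agent of a variable the dummies are the buffer between liked and disliked values. The
    last clause ties each of the other groups to a dummy of its own. *)
Definition acls (i a : nat) : nat :=
  if i %/ cap < V then
    if a < nalt1 then
      if likes (i %/ cap) (slot_of (i %% cap)) (a %/ nvals) (val_of (a %% nvals))
      then 0 else 2
    else 1
  else if a < nalt1 then 2 else if a - nalt1 == i %/ cap - V then 0 else 1.

Lemma acls3 i a : acls i a < 3.
Proof. by rewrite /acls; repeat case: ifP. Qed.

Lemma cap_gt0 : 0 < cap.
Proof. by apply/card_gt0P; exists None. Qed.

Lemma nvals_gt0 : 0 < nvals.
Proof. by apply/card_gt0P; exists d0. Qed.

Lemma nalt1_gt0 : 0 < nalt1.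
Proof. by rewrite muln_gt0 V0 nvals_gt0. Qed.

Lemma nag_gt0 : 0 < nag.
Proof. by rewrite muln_gt0 cap_gt0 addn_gt0 V0. Qed.

Lemma nag_div : nag %/ nwin = cap.
Proof. by rewrite mulnK // addn_gt0 V0. Qed.

Lemma group_lt (i : 'I_nag) : i %/ cap < nwin.
Proof. by rewrite ltn_divLR ?cap_gt0 // mulnC ltn_ord. Qed.

Lemma agent_lt g (s : slot) : g < nwin -> g * cap + frank s < nag.
Proof.
move=> gK; apply: (@leq_trans (g.+1 * cap)); first by rewrite mulSn addnC ltn_add2r frank_lt.
by rewrite /nag mulnC leq_mul2l gK orbT.
Qed.

Definition agent (g : nat) (s : slot) : 'I_nag :=
  insubd (Ordinal nag_gt0) (g * cap + frank s).

Lemma agentE g s : g < nwin -> val (agent g s) = g * cap + frank s.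
Proof. by move=> gK; rewrite /agent val_insubd agent_lt. Qed.

Lemma agent_group g s : g < nwin -> agent g s %/ cap = g.
Proof.
move=> gK; rewrite [X in X %/ _]agentE // divnMDl ?cap_gt0 //.
by rewrite divn_small ?addn0 // frank_lt.
Qed.

Lemma agent_slot g s : g < nwin -> slot_of (agent g s %% cap) = s.
Proof.
move=> gK; rewrite [X in X %% _]agentE // modnMDl modn_small ?frank_lt //.
exact: frankK.
Qed.

Lemma agent_eta (i : 'I_nag) : agent (i %/ cap) (slot_of (i %% cap)) = i.
Proof.
apply: val_inj; rewrite agentE ?group_lt // nth_frank ?ltn_pmod ?cap_gt0 //.
by rewrite -divn_eq.
Qed.

Definition prev (i : bool) (v : nat) : nat := (v + (V - sh i)) %% V.

Lemma nbK i v : v < V -> prev i (nb i v) = v.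
Proof.
move=> vV; rewrite /prev /nb modnDml -addnA subnKC // modnDr.
by rewrite modn_small.
Qed.

Lemma nb_lt i v : nb i v < V.
Proof. by rewrite ltn_pmod. Qed.

(** * From solutions to assignments *)

Section Complete.
Variable f : nat -> D.
Hypothesis fP : csp_sol f.

(** The variable whose value serves the slot. If [f g] has another colour than [h], then by the
    constraint so has the value of the neighbour, which is therefore liked. *)
Definition target (g : nat) (s : slot) : nat :=
  match s with
  | None => g
  | Some (j, h) => if lc j (f g) == h then g else nb j g
  end.

Definition galt (v : nat) : nat :=
  if v < V then v * nvals + frank (f v) else nalt1 + (v - V).

Definition psi (i : nat) : nat :=
  let g := i %/ cap in galt (if g < V then target g (slot_of (i %% cap)) else g).

Lemma target_lt g s : g < V -> target g s < V.
Proof. by case: s => [[j h]|] //= gV; case: ifP => // _; apply: nb_lt. Qed.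

Lemma galt_lt1 v : v < V -> galt v < nalt1.
Proof.
move=> vV; rewrite /galt vV; apply: (@leq_trans (v.+1 * nvals)).
  by rewrite mulSn addnC ltn_add2r frank_lt.
by rewrite leq_mul2r vV orbT.
Qed.

Lemma galt_lt v : v < nwin -> galt v < nalt.
Proof.
move=> vK; case: (ltnP v V) => vV; first by apply: ltn_addr; apply: galt_lt1.
by rewrite /galt (ltnNge v) vV /= ltn_add2l ltn_subLR.
Qed.

Lemma galt_var v : v < V -> galt v %/ nvals = v /\ val_of (galt v %% nvals) = f v.
Proof.
move=> vV; rewrite /galt vV divnMDl ?nvals_gt0 // divn_small ?addn0 ?frank_lt //.
by rewrite modnMDl modn_small ?frank_lt //; split=> //; apply: frankK.
Qed.

Lemma psi_lt (i : 'I_nag) : psi i < nalt.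
Proof.
rewrite /psi; apply: galt_lt; case: ifP => gV; last exact: group_lt.
exact: leq_trans (target_lt _ gV) (leq_addr _ _).
Qed.

Definition Psi (i : 'I_nag) : 'I_nalt := Ordinal (psi_lt i).

Lemma acls_psi i : acls i (psi i) = 0.
Proof.
rewrite /acls /psi; case gV: (_ %/ _ < V).
  set g := i %/ cap in gV *; set s := slot_of _; have tV := target_lt s gV.
  rewrite galt_lt1 //; have [-> ->] := galt_var tV.
  have [okt _] := fP tV; rewrite /likes okt /= /target.
  case: s okt tV => [[j h]|] _ _ /=; last by rewrite eqxx.
  case: (lc j (f g) =P h) => [<-|/eqP ne]; first by rewrite !eqxx.
  have [_ /(_ j) e] := fP gV.
  by rewrite -e ne andbT eqxx orbT.
by rewrite /galt gV (ltnNge _ nalt1) leq_addr /= addKn eqxx.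
Qed.

Lemma acls_Psi (i : 'I_nag) : acls i (Psi i) = 0.
Proof. exact: acls_psi. Qed.

Lemma Psi_feasible : monroe_feasible nag nalt nwin Psi.
Proof.
split.
  pose h (g : 'I_nwin) : 'I_nalt := Ordinal (galt_lt (ltn_ord g)).
  apply: (@leq_trans #|[set h g | g : 'I_nwin]|); last first.
    by apply: leq_trans (leq_imset_card _ _) _; rewrite card_ord.
  apply: subset_leq_card; apply/subsetP => _ /imsetP[i _ ->].
  have gK : (if i %/ cap < V then target (i %/ cap) (slot_of (i %% cap)) else i %/ cap) < nwin.
    case: ifP => gV; last exact: group_lt.
    exact: leq_trans (target_lt _ gV) (leq_addr _ _).
  by apply/imsetP; exists (Ordinal gK) => //; apply: val_inj.
move=> a; rewrite nag_div.
(* The agents served by the value of [v] are indexed by slots: slot [None] of [v], the slots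
   [(j, lc j (f v))] of [v], and the slots [(j, h)] of [prev j v] with [h] other than [rc j (f v)].
   The second kind takes the index left free by the third, so that there are at most [cap] of
   them. *)
pose hv v (s : slot) := match s with
  | None => agent v None
  | Some (j, h) => if h == rc j (f v) then agent v (Some (j, lc j (f v)))
                   else agent (prev j v) (Some (j, h))
  end.
pose h (s : slot) := if a < nalt1 then hv (a %/ nvals) s else agent (V + (a - nalt1)) s.
apply: (@leq_trans #|[set h s | s : slot]|); last exact: leq_imset_card.
apply: subset_leq_card; apply/subsetP => i; rewrite inE => /eqP/(congr1 val) /= ia.
rewrite -(agent_eta i); move: ia; rewrite /psi; set g := i %/ cap; set s := slot_of _.
have gK : g < nwin by apply: group_lt.
case: ifP => gV ia; apply/imsetP; last first.
  exists s => //; rewrite /h -ia /galt gV ltnNge leq_addr /= addKn subnKC //.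
  by rewrite leqNgt gV.
have tV := target_lt s gV; have [tE _] := galt_var tV.
have hE s' : h s' = hv (target g s) s' by rewrite /h -ia galt_lt1 // tE.
case: s ia tV tE hE => [[j x]|] ia tV tE hE; last by exists None; rewrite // hE.
have [_ /(_ j) e] := fP gV.
move: hE; rewrite /target; case: eqP => [<-|/eqP ne] hE.
  by exists (Some (j, rc j (f g))) => //; rewrite hE /= eqxx.
by exists (Some (j, x)) => //; rewrite hE /= -e eq_sym (negPf ne) nbK.
Qed.
End Complete.

(** * From assignments to solutions *)

Lemma card_alt2 : #|[set a : 'I_nalt | nalt1 <= a]| = mp.
Proof. by rewrite card_ord_geq addKn. Qed.

(** The agents of dummies accept only dummies and fill them to capacity. Hence agents of variables
    get values, at most [V] different ones. The slots [None] use one value of each variable, so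
    these are all. *)
Lemma sound (Phi : 'I_nag -> 'I_nalt) : monroe_feasible nag nalt nwin Phi ->
  (forall i : 'I_nag, acls i (Phi i) != 2) -> exists f, csp_sol f.
Proof.
move=> [imK fib] cls2; rewrite nag_div in fib.
pose N2 := [set i : 'I_nag | V * cap <= i]; pose N1 := ~: N2.
have N2E (i : 'I_nag) : (i \in N2) = ~~ (i %/ cap < V).
  by rewrite inE ltn_divLR ?cap_gt0 // leqNgt.
pose X := [set i : 'I_nag | nalt1 <= Phi i].
have N2X : N2 \subset X.
  apply/subsetP => i; rewrite N2E inE => /negPf gV; move: (cls2 i).
  by rewrite /acls gV; case: ltnP.
have cN2 : #|N2| = cap * mp.
  by rewrite card_ord_geq /nag /nwin mulnDr mulnC addKn.
have cX : #|X| <= cap * mp.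
  apply: leq_trans (card_fibers X fib) _; rewrite leq_mul2l -card_alt2.
  apply/orP; right; apply: subset_leq_card; apply/subsetP => _ /imsetP[i iX ->].
  by move: iX; rewrite !inE.
have {cX N2X} XN2 : X = N2.
  by apply/esym/eqP; rewrite eqEcard N2X cN2.
have cPN2 : mp <= #|Phi @: N2|.
  by rewrite -(leq_pmul2l cap_gt0) -cN2; apply: card_fibers.
have cPN1 : #|Phi @: N1| <= V.
  have dis : [disjoint Phi @: N1 & Phi @: N2].
    rewrite disjoint_subset; apply/subsetP => _ /imsetP[i iN1 ->].
    rewrite inE; apply/imsetP => -[j jN2 e].
    have iX : i \notin X by rewrite XN2 -in_setC.
    have jX : j \in X by rewrite XN2.
    by move: iX jX; rewrite !inE e => /negPf ->.
  have : #|Phi @: N1| + #|Phi @: N2| <= V + mp.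
    rewrite -cardsUI (disjoint_setI0 dis) cards0 addn0.
    apply: leq_trans imK; apply: subset_leq_card; apply/subsetP => a.
    by rewrite inE => /orP[] /imsetP[i _ ->]; apply: imset_f.
  lia.
have Vwin v : v < V -> v < nwin by move=> vV; apply: leq_trans vV (leq_addr _ _).
pose B := [set Phi (agent v None) | v : 'I_V].
have N1E g s : g < V -> agent g s \in N1.
  by move=> gV; rewrite inE N2E agent_group ?Vwin // gV.
have inN1 i : i \in N1 -> Phi i < nalt1.
  by rewrite inE -XN2 inE -ltnNge.
have lk g s : g < V -> let a := Phi (agent g s) in
    likes g s (a %/ nvals) (val_of (a %% nvals)).
  move=> gV /=; move: (cls2 (agent g s)); rewrite /acls agent_group ?Vwin // gV.
  by rewrite inN1 ?N1E // agent_slot ?Vwin //; case: ifP.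
have PhiN v : v < V -> Phi (agent v None) %/ nvals = v.
  by move=> vV; have := lk v None vV; rewrite /likes => /andP[_ /eqP].
have cB : #|B| = V.
  rewrite card_imset ?card_ord // => v w e; apply: val_inj.
  have := congr1 (fun a : 'I_nalt => a %/ nvals) e.
  by rewrite !PhiN.
have BN1 : B = Phi @: N1.
  apply/eqP; rewrite eqEcard cB cPN1 andbT; apply/subsetP => _ /imsetP[v _ ->].
  by apply: imset_f; apply: N1E.
pose f v := val_of (Phi (agent v None) %% nvals).
exists f => v vV; split.
  by have := lk v None vV; rewrite /likes PhiN // => /andP[].
(* The value chosen at the neighbour has colour [h], so that the slot [(i, h)] of [v] does not like
   it. This slot therefore has the value chosen at [v], whose colour must be [h]. *)
move=> i; set h := rc i (f (nb i v)).
have := lk v (Some (i, h)) vV.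
have : Phi (agent v (Some (i, h))) \in B by rewrite BN1 imset_f // N1E.
case/imsetP => w _ ->; rewrite /likes PhiN // -/(f w) => /andP[_].
case/orP=> /andP[/eqP wv]; first by rewrite wv => /eqP.
by rewrite wv eqxx.
Qed.

Lemma count_acls0 i : count (fun a => acls i a == 0) (iota 0 nalt) <= nalt1.
Proof.
rewrite /nalt iotaD count_cat add0n; case: (ltnP (i %/ cap) V) => gV.
  have -> : count (fun a => acls i a == 0) (iota nalt1 mp) = 0.
    apply/eqP; rewrite -leqn0 leqNgt -has_count; apply/hasPn => a.
    by rewrite mem_iota /acls gV => /andP[le _]; rewrite ltnNge le.
  by rewrite addn0 -[in X in _ <= X](size_iota 0 nalt1) count_size.
have -> : count (fun a => acls i a == 0) (iota 0 nalt1) = 0.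
  apply/eqP; rewrite -leqn0 leqNgt -has_count; apply/hasPn => a.
  by rewrite mem_iota /acls (ltnNge (i %/ cap)) gV /= => ->.
rewrite add0n; apply: leq_trans nalt1_gt0; rewrite -size_filter.
apply: (@uniq_leq_size _ _ [:: nalt1 + (i %/ cap - V)]); first by rewrite filter_uniq ?iota_uniq.
move=> a; rewrite mem_filter mem_iota inE /acls (ltnNge (i %/ cap)) gV /= => /and3P[+ le _].
rewrite (ltnNge a) le /=; case: (a - nalt1 =P _) => // e _; apply/eqP; lia.
Qed.

Lemma count_acls2 i : mp <= count (fun a => acls i a != 2) (iota 0 nalt).
Proof.
rewrite /nalt iotaD count_cat add0n; apply: leq_trans (leq_addl _ _).
rewrite -[leqLHS](size_iota nalt1 mp) -[leqRHS]addn0 leq_eqVlt; apply/orP; left.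
rewrite addn0 eq_sym -all_count; apply/allP => a; rewrite mem_iota /acls => /andP[le _].
by rewrite (ltnNge a) le; repeat case: ifP.
Qed.

Definition profile : 'I_nag -> {perm 'I_nalt} :=
  list_profile (fun i => class_order_perm nalt (acls3 i)).

(** * The gap between liked and disliked alternatives *)

Section Values.
Variable alpha : nat -> nat -> nat.
Hypothesis normal : normal_DPSF alpha.

(** A liked alternative is among the first [nalt1], so at least [mp] alternatives are ranked below
    it. *)
Lemma value_class0 (i : 'I_nag) (a : 'I_nalt) : acls i a = 0 -> mp <= alpha nalt (pos nag nalt profile i a).
Proof.
move=> ca; rewrite pos_list_profile.
have lt := index_class0 (cls := acls i) (ltn_ord a) ca.
have := leq_trans lt (count_acls0 i); set p := index _ _ => le.
by apply: leq_trans (alpha_lower normal _ _); rewrite // /nalt; lia.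
Qed.

(** At least [mp] alternatives precede a disliked one. Removing [mp] positions from the top by
    [alpha_shift] leaves at best the first of [nalt1] positions. *)
Lemma value_class2 (i : 'I_nag) (a : 'I_nalt) : acls i a = 2 -> alpha nalt (pos nag nalt profile i a) <= alpha nalt1 1.
Proof.
move=> ca; rewrite pos_list_profile.
have lt := index_class2 (acls3 i) (ltn_ord a) ca.
have := leq_trans (count_acls2 i) lt; set p := index _ _ => le.
have pm : p < nalt.
  rewrite /p -[X in _ < X](size_iota 0 nalt) -(perm_size (class_order_perm nalt (acls3 i))).
  by rewrite index_mem (perm_mem (class_order_perm nalt (acls3 i))) mem_iota ltn_ord.
rewrite -(alpha_shift normal mp (i := 1)) ?nalt1_gt0 // add1n.
exact: alpha_anti.
Qed.

Lemma lmin_le (sigma : 'I_nag -> {perm 'I_nalt}) Phi i :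
  lmin alpha nag nalt sigma Phi <= alpha nalt (pos nag nalt sigma i (Phi i)).
Proof.
rewrite /lmin; have := mem_index_enum i; elim: (index_enum _) => //= j r IH.
by rewrite inE big_cons geq_min => /orP[/eqP <-|/IH ->]; rewrite ?leqnn ?orbT.
Qed.

Lemma lmin_ge (sigma : 'I_nag -> {perm 'I_nalt}) Phi b :
  (forall i, b <= alpha nalt (pos nag nalt sigma i (Phi i))) ->
  b <= lmin alpha nag nalt sigma Phi.
Proof.
move=> le; have i0 := Ordinal nag_gt0; apply: (big_ind (fun x => b <= x)) => //.
  apply: leq_trans (le i0) _; apply: alpha_anti => //; rewrite /pos.
  exact: ltn_ord.
by move=> x y bx by'; rewrite leq_min bx.
Qed.
End Values.

(** Solvable constraints or not, group [g] may take alternative [g]; there are enough alternatives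
    because every variable has at least one value. *)
Lemma valid_reduction : valid_instance nag nalt nwin.
Proof.
split; rewrite ?nag_gt0 ?addn_gt0 ?V0 ?dvdn_mull //.
have gl (i : 'I_nag) : i %/ cap < nalt.
  apply: leq_trans (group_lt i) _; rewrite leq_add2r leq_pmulr ?nvals_gt0 //.
exists (fun i => Ordinal (gl i)); split.
  have Kl (g : 'I_nwin) : g < nalt.
    by apply: leq_trans (ltn_ord g) _; rewrite leq_add2r leq_pmulr ?nvals_gt0.
  apply: (@leq_trans #|[set Ordinal (Kl g) | g : 'I_nwin]|); last first.
    by apply: leq_trans (leq_imset_card _ _) _; rewrite card_ord.
  apply: subset_leq_card; apply/subsetP => _ /imsetP[i _ ->].
  by apply/imsetP; exists (Ordinal (group_lt i)) => //; apply: val_inj.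
move=> a; rewrite nag_div.
apply: (@leq_trans #|[set agent a s | s : slot]|); last exact: leq_imset_card.
apply: subset_leq_card; apply/subsetP => i; rewrite inE => /eqP/(congr1 val) /= <-.
by apply/imsetP; exists (slot_of (i %% cap)); rewrite ?agent_eta.
Qed.
End Reduction.


(** * The decision procedure *)

Import Order.TTheory GRing.Theory Num.Theory.

(** Halted configurations are fixed, so that an unknown running time may be replaced by a computable
    bound. *)
Lemma runs_output M x t y T : runs M x t y -> t <= T ->
  tm_output M (iter T (tm_step M) (tm_init M x)) = y.
Proof.
move=> [hc out] le; rewrite -(subnK le) iterD; set c := iter t _ _ in hc out *.
suff -> : iter (T - t) (tm_step M) c = c by [].
elim: (T - t) => //= n ->; case: c hc {out} => q [[l h] r] /= hq.
by rewrite hq.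
Qed.

Definition next_code (w : str) : str := drop (index false w).+1 w.
Definition decode (i : nat) (w : str) : nat := index false (iter i next_code w).

Lemma decode_enc (F : nat -> nat) i n : i < n ->
  decode i (flatten [seq enc_nat (F j) | j <- iota 0 n]) = F i.
Proof.
rewrite -[in RHS](add0n i) /decode; elim: i n 0 => [|i IH] [|n] j //; rewrite ?ltnS => lt.
  by rewrite /= index_enc_nat addn0.
by rewrite iterSr /= /next_code index_enc_nat drop_enc_nat IH // addSnnS.
Qed.

Lemma FN_decode i w : FN i -> FP w -> FN (fun e => decode (i e) (w e)).
Proof.
move=> Fi Fw; apply: FN_index; have [c [k hw]] := FP_size Fw.
apply: (@FP_iter (pb c k) i w (fun a _ => next_code a)) => //; first by polybd.
  by apply: FP_drop; [apply: FN_S; apply: FN_index|]; exact: FP_nth.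
move=> e j _; apply: leq_trans (hw e); elim: j => //= j; apply: leq_trans.
by rewrite size_drop leq_subr.
Qed.

Section Decision.
Variables (D C : finType) (d0 : D) (V mp : str -> nat) (sh : str -> bool -> nat).
Variables (ok : str -> nat -> D -> bool) (lc rc : bool -> D -> C).
Hypothesis V0 : forall x, 0 < V x.
Hypothesis sh_le : forall x i, sh x i <= V x.
Hypothesis FV : forall fx, FP fx -> FN (fun e => V (fx e)).
Hypothesis Fmp : forall fx, FP fx -> FN (fun e => mp (fx e)).
Hypothesis Fsh : forall fx i, FP fx -> FN (fun e => sh (fx e) i).
Hypothesis Fok : forall fx fv d, FP fx -> FN fv -> FB (fun e => ok (fx e) (fv e) d).

Notation xcls x := (acls d0 (V x) (sh x) (ok x) lc rc).
Notation xnalt x := (nalt D (V x) (mp x)).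
Notation xnag x := (nag C (V x) (mp x)).
Notation xnwin x := (nwin (V x) (mp x)).

Lemma FN_acls fx fi fa : FP fx -> FN fi -> FN fa ->
  FN (fun e => xcls (fx e) (fi e) (fa e)).
Proof.
move=> Fx Fi Fa; have FVx := FV Fx.
have Fg : FN (fun e => fi e %/ cap C) by exact: FN_div Fi (FN_cst _).
have Fa1 : FB (fun e => fa e < nalt1 D (V (fx e))).
  by apply: FB_ltn => //; exact: FN_mul FVx (FN_cst _).
have Fw : FN (fun e => fa e %/ nvals D) by exact: FN_div Fa (FN_cst _).
have Fl : FB (fun e => likes (V (fx e)) (sh (fx e)) (ok (fx e)) lc rc (fi e %/ cap C)
    (slot_of C (fi e %% cap C)) (fa e %/ nvals D) (val_of d0 (fa e %% nvals D))).
  (* With the slot and the value fixed by case distinction, all conditions on colours are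
     constants. *)
  apply: (@FB_case (cap C) (fun e => fi e %% cap C) (fun s e =>
    likes (V (fx e)) (sh (fx e)) (ok (fx e)) lc rc (fi e %/ cap C)
      (slot_of C s) (fa e %/ nvals D) (val_of d0 (fa e %% nvals D)))).
  - exact: FN_mod Fi (FN_cst _).
  - by move=> e; rewrite ltn_pmod ?cap_gt0.
  move=> s _; apply: (@FB_case (nvals D) (fun e => fa e %% nvals D) (fun t e =>
    likes (V (fx e)) (sh (fx e)) (ok (fx e)) lc rc (fi e %/ cap C)
      (slot_of C s) (fa e %/ nvals D) (val_of d0 t))).
  - exact: FN_mod Fa (FN_cst _).
  - by move=> e; rewrite ltn_pmod ?(nvals_gt0 d0).
  move=> t _; rewrite /likes; apply: FB_and; first exact: Fok.
  case: (slot_of C s) => [[i h]|]; last exact: FB_eqn.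
  apply: FB_or; apply: FB_and; rewrite ?(FB_cst (_ == _)) ?(FB_cst (_ != _)) //.
  - exact: FB_eqn.
  - exact: FB_cst.
  - apply: FB_eqn => //; apply: FN_mod => //; apply: FN_add => //; exact: Fsh.
  - exact: FB_cst.
apply: FN_if; first exact: FB_ltn.
  apply: FN_if Fa1 _ (FN_cst 1).
  exact: FN_if Fl (FN_cst 0) (FN_cst 2).
apply: FN_if Fa1 (FN_cst 2) _; apply: FN_if _ (FN_cst 0) (FN_cst 1).
apply: FB_eqn; apply: FN_sub => //.
exact: FN_mul FVx (FN_cst _).
Qed.

Definition instance_str (x : str) : str :=
  enc_nat (xnag x) ++ enc_nat (xnalt x) ++ enc_nat (xnwin x) ++
  flatten [seq flatten [seq enc_nat a | a <- class_order (xnalt x) (xcls x i)]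
          | i <- iota 0 (xnag x)].

Lemma FN_xnalt fx : FP fx -> FN (fun e => xnalt (fx e)).
Proof. by move=> Fx; apply: FN_add (Fmp Fx); exact: FN_mul (FV Fx) (FN_cst _). Qed.

Lemma FN_xnwin fx : FP fx -> FN (fun e => xnwin (fx e)).
Proof. by move=> Fx; apply: FN_add (FV Fx) (Fmp Fx). Qed.

Lemma FN_xnag fx : FP fx -> FN (fun e => xnag (fx e)).
Proof. by move=> Fx; apply: FN_mul (FN_cst _) (FN_xnwin Fx). Qed.

Lemma FP_instance : FP (fun e => instance_str (nth [::] e 0)).
Proof.
have Fx := FP_nth 0.
apply: FP_cat; first exact: FP_enc_nat (FN_xnag Fx).
apply: FP_cat; first exact: FP_enc_nat (FN_xnalt Fx).
apply: FP_cat; first exact: FP_enc_nat (FN_xnwin Fx).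
apply: (@FP_flatten (fun e => xnag (nth [::] e 0)) (fun i e =>
  flatten [seq enc_nat a | a <- class_order (xnalt (nth [::] e 0)) (xcls (nth [::] e 0) i)])).
  exact: FN_xnag.
have Fx1 := FP_behead Fx.
have Fc c : FP (fun e => flatten [seq if xcls (nth [::] (behead e) 0) (size (nth [::] e 0)) a == c
    then enc_nat a else [::] | a <- iota 0 (xnalt (nth [::] (behead e) 0))]).
  apply: (@FP_flatten (fun e => xnalt (nth [::] (behead e) 0)) (fun a e =>
    if xcls (nth [::] (behead e) 0) (size (nth [::] e 0)) a == c then enc_nat a else [::])).
    exact: FN_xnalt.
  apply: FP_if _ (FP_enc_nat (FN_var 0)) FP_nil.
  apply: FB_eqn (FN_cst c); apply: FN_acls (FN_var 0); first exact: (FP_behead Fx1).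
  exact: (FN_behead (FN_var 0)).
apply: FP_ext (FP_cat (Fc 0) (FP_cat (Fc 1) (Fc 2))) _ => e.
rewrite /class_order !map_cat !flatten_cat.
have E c (s : seq nat) : flatten [seq if xcls (nth [::] (behead e) 0) (size (nth [::] e 0)) a == c
    then enc_nat a else [::] | a <- s] =
    flatten [seq enc_nat a | a <- [seq a <- s | xcls (nth [::] (behead e) 0) (size (nth [::] e 0)) a == c]].
  by elim: s => //= a s ->; case: ifP.
by rewrite !E.
Qed.

(** The approximation algorithm is run for its time bound, and [x] is accepted iff nobody gets a
    disliked alternative. Acceptance implies solvability by [sound], the converse is due to the
    gap. *)
Lemma gap_decides (alpha : nat -> nat -> nat) (R : realType) (r : R) (M : TM) ca ka rho :
  normal_DPSF alpha -> approx_algorithm alpha R r M -> (0 < r)%R ->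
  (forall m, 1 <= m -> alpha m 1 <= poly_bound ca ka m) ->
  (1 <= r * rho%:R)%R ->
  (forall x, mp x = rho * poly_bound ca ka (nalt1 D (V x)) + 1) ->
  exists2 dec : str -> bool, FB (fun e => dec (nth [::] e 0)) &
    forall x, dec x <-> exists f, csp_sol (V x) (sh x) (ok x) lc rc f.
Proof.
move=> normal [c [k apx]] r0 pbd rho1 mpE.
pose out x := tm_output M (iter (poly_bound c k (size (instance_str x))) (tm_step M)
  (tm_init M (instance_str x))).
pose dec x := all (fun i => xcls x i (decode i (out x)) != 2) (iota 0 (xnag x)).
exists dec.
  have Fx := FP_nth 0; have Fo : FP (fun e => out (nth [::] e 0)).
    apply: FP_tm_output; first exact: FP_instance.
    by apply: FN_poly_bound; apply: FN_size; exact: FP_instance.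
  apply: (@FB_all (fun e => xnag (nth [::] e 0)) (fun i e =>
    xcls (nth [::] e 0) i (decode i (out (nth [::] e 0))) != 2)); first exact: FN_xnag.
  apply: FB_not; apply: FB_eqn (FN_cst 2); apply: FN_acls.
  - exact: (FP_behead Fx).
  - exact: FN_var.
  - by apply: FN_decode; [exact: FN_var|exact: (FP_behead Fo)].
move=> x; set m := xnalt x; set n := xnag x.
pose sigma := @profile D C d0 (V x) (mp x) (sh x) (ok x) lc rc.
have [t [Phi [tb run feas opt]]] := apx n m (xnwin x) sigma (valid_reduction C d0 (mp x) (V0 x)).
have instE : enc_instance n m (xnwin x) sigma = instance_str x by exact: enc_list_profile.
rewrite instE in tb run.
have outE : out x = enc_assignment n m Phi by apply: runs_output run tb.
have decE (i : 'I_n) : decode i (out x) = Phi i.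
  rewrite outE /enc_assignment.
  have -> : [seq enc_nat (Phi i) | i <- enum 'I_n] =
      [seq enc_nat (if insub j is Some i then Phi i else 0) | j <- iota 0 n].
    by rewrite -val_enum_ord -map_comp; apply: eq_map => j; rewrite /= valK.
  rewrite (@decode_enc (fun j => if insub j is Some i then Phi i else 0)) ?ltn_ord //.
  by rewrite valK.
split.
  move=> /allP ad; apply: (sound (V0 x) feas) => i.
  by rewrite -decE; apply: ad; rewrite mem_iota ltn_ord.
move=> [f fP]; apply/allP => i; rewrite mem_iota add0n => /andP[_ lt].
rewrite (decE (Ordinal lt)); apply/eqP => ci.
have le1 : mp x <= lmin alpha n m sigma (Psi (sh x) lc (V0 x) f).
  by apply: (lmin_ge (V0 x) normal) => j; apply: (value_class0 (V0 x) normal); apply: acls_Psi.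
have le2 : lmin alpha n m sigma Phi <= poly_bound ca ka (nalt1 D (V x)).
  apply: leq_trans (lmin_le _ _ _ (Ordinal lt)) _.
  have v2 := value_class2 (V0 x) normal (i := Ordinal lt) (a := Phi (Ordinal lt)) ci.
  apply: leq_trans v2 (pbd _ _).
  exact: (nalt1_gt0 d0 (V0 x)).
have := opt _ (Psi_feasible d0 (mp x) (V0 x) (sh_le x) fP).
(* A disliked alternative limits the value of the output to [P], the polynomial bound at [nalt1],
   while [r * mp = r * rho * P + r > P]. *)
apply/negP; rewrite -ltNge; apply: (@le_lt_trans _ _ (poly_bound ca ka (nalt1 D (V x)))%:R%R).
  by rewrite ler_nat.
apply: (@lt_le_trans _ _ (r * (mp x)%:R)%R); last by rewrite ler_pM2l // ler_nat.
rewrite mpE natrD natrM mulrDr mulrA mulr1.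
apply: ltr_pwDr => //; rewrite -[leLHS]mul1r ler_wpM2r //.
Qed.
End Decision.


(** * Computations as constraint satisfaction *)

Section Tableau.
Variable N : TM.

(* Contents of a tape cell: the state when the head is there, and the symbol. *)
Definition cell : finType := (option (tm_state N) * option bool)%type.
Definition blank : cell := (None, None).

(** A halted head counts as staying in place and rewriting its symbol, so that a final configuration
    is repeated in all later rows. *)
Definition act (g : cell) : option (tm_state N * option bool * move) :=
  if g.1 is Some q then
    Some (if tm_halt N q then (q, g.2, Stay) else tm_delta N q g.2)
  else None.

Definition next_state (x c y : cell) : option (tm_state N) :=
  if act c is Some (q, _, Stay) then Some q else
  if act x is Some (q, _, MoveR) then Some q else
  if act y is Some (q, _, MoveL) then Some q else None.

Definition next_cell (x c y : cell) : cell :=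
  (next_state x c y, if act c is Some (_, w, _) then w else c.2).

(** The number is the absolute position of the head, which the two lists of a tape do not record. *)
Definition pconfig := (nat * config N)%type.

Definition pstep (d : pconfig) : pconfig :=
  let: (z, (q, (l, h, r))) := d in
  (if tm_halt N q then z else
   match (tm_delta N q h).2 with Stay => z | MoveL => z.-1 | MoveR => z.+1 end,
   tm_step N d.2).

Definition symbol (z : nat) (l rr : seq (option bool)) (p : nat) : option bool :=
  if p < z then nth None l (z - p).-1 else nth None rr (p - z).

Definition contents (d : pconfig) (p : nat) : cell :=
  let: (z, (q, (l, h, r))) := d in
  (if p == z then Some q else None, symbol z l (h :: r) p).

Lemma symbolR z l h r w p :
  symbol z.+1 (w :: l) r p = if p == z then w else symbol z l (h :: r) p.
Proof.
rewrite /symbol; case: eqP => [->|pz]; first by rewrite ltnSn subSnn.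
case: (ltnP p z) => lt; first by rewrite ltnS ltnW // subSn ?(ltnW lt) //= -(ltn_predK (_ : 0 < z - p)) // subn_gt0.
rewrite ltnNge (_ : z < p) ?[~~ _]/=; last by lia.
by have -> : p - z = (p - z.+1).+1 by lia.
Qed.

Lemma symbolL z l h r w p : 0 < z ->
  symbol z.-1 (behead l) (head None l :: w :: r) p =
  if p == z then w else symbol z l (h :: r) p.
Proof.
move=> z0; rewrite /symbol; case: eqP => [->|pz].
  by rewrite ltnNge leq_pred /=; have -> : z - z.-1 = 1 by lia.
have [lt|[lt|lt]] : p < z.-1 \/ p = z.-1 \/ z < p by lia.
- rewrite lt (_ : p < z); last by lia.
  by rewrite nth_behead; congr nth; lia.
- rewrite lt ltnn subnn /= (_ : z.-1 < z); last by lia.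
  by have -> : (z - z.-1).-1 = 0 by lia.
- rewrite !ifF; [|by lia..].
  by have [-> ->] : p - z.-1 = (p - z.+1).+2 /\ p - z = (p - z.+1).+1 by lia.
Qed.

Lemma symbol_write z l h r w p :
  symbol z l (w :: r) p = if p == z then w else symbol z l (h :: r) p.
Proof.
rewrite /symbol; case: eqP => [->|pz]; first by rewrite ltnn subnn.
by case: ltnP => // le; have -> : p - z = (p - z.+1).+1 by lia.
Qed.

Lemma symbol_nilR z l p : symbol z l [:: None] p = symbol z l [::] p.
Proof. by rewrite /symbol; case: ltnP => // _; rewrite nth_nil; case: (_ - _) => // -[]. Qed.

Lemma contents_pstep z q l h r p : 0 < z ->
  contents (pstep (z, (q, (l, h, r)))) p =
  if tm_halt N q then contents (z, (q, (l, h, r))) p else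
  let: (q', w, mv) := tm_delta N q h in
  (if p == match mv with Stay => z | MoveL => z.-1 | MoveR => z.+1 end then Some q' else None,
   if p == z then w else symbol z l (h :: r) p).
Proof.
move=> z0; rewrite /pstep /=; case: ifP => hq //.
case: (tm_delta N q h) => [[q' w] []] /=.
- by rewrite -(symbolL l h) //; case: (l).
- by rewrite -(symbolR z l h r); case: (r) => //=; rewrite symbol_nilR.
- by rewrite -(symbol_write z l h r).
Qed.

(** Only the cell under the head is rewritten, and the head comes from the cell itself or from one
    of its neighbours. *)
Lemma contents_step d p : 0 < d.1 -> 0 < p ->
  contents (pstep d) p = next_cell (contents d p.-1) (contents d p) (contents d p.+1).
Proof.
case: d => z [q [[l h] r]] z0 p0; rewrite contents_pstep //; move: z0 => /= z0.
rewrite /next_cell /next_state /act /=.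
have symz : symbol z l (h :: r) z = h by rewrite /symbol ltnn subnn.
case: ifP => hq.
  case: (p =P z) => [->|pz] /=; first by rewrite hq symz.
  by case: (p.-1 =P z) => _ /=; case: (p.+1 =P z) => _ /=; rewrite ?hq.
case E : (tm_delta N q h) => [[q' w] mv] /=.
have pz1 : (p.-1 == z) = (p == z.+1) by lia.
have pz2 : (p.+1 == z) = (p == z.-1) by lia.
have e1 : p.-1 == z -> symbol z l (h :: r) p.-1 = h by move/eqP->.
have e2 : p.+1 == z -> symbol z l (h :: r) p.+1 = h by move/eqP->.
have st : (if (if p == z then Some q else None) is Some q then
     Some (if tm_halt N q then (q, symbol z l (h :: r) p, Stay)
           else tm_delta N q (symbol z l (h :: r) p)) else None)
   = if p == z then Some (q', w, mv) else None.
  by case: eqP => // ->; rewrite hq symz E.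
have st1 : (if (if p.-1 == z then Some q else None) is Some q then
     Some (if tm_halt N q then (q, symbol z l (h :: r) p.-1, Stay)
           else tm_delta N q (symbol z l (h :: r) p.-1)) else None)
   = if p == z.+1 then Some (q', w, mv) else None.
  by rewrite -pz1; case: eqP => // ->; rewrite hq symz E.
have st2 : (if (if p.+1 == z then Some q else None) is Some q then
     Some (if tm_halt N q then (q, symbol z l (h :: r) p.+1, Stay)
           else tm_delta N q (symbol z l (h :: r) p.+1)) else None)
   = if p == z.-1 then Some (q', w, mv) else None.
  by rewrite -pz2; case: eqP => // ->; rewrite hq symz E.
rewrite st st1 st2.
have -> : match (if p == z then Some (q', w, mv) else None) with
   | Some (_, w0, _) => w0 | None => symbol z l (h :: r) p end
   = if p == z then w else symbol z l (h :: r) p by case: eqP.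
by case: mv {E st st1 st2}; congr (_, _);
  case: (p =P z) => ?; case: (p =P z.+1) => ?; case: (p =P z.-1) => ? //=; lia.
Qed.

Definition trace (O : nat) (w : str) (t : nat) : pconfig := iter t pstep (O, tm_init N w).

Lemma trace_config O w t : (trace O w t).2 = iter t (tm_step N) (tm_init N w).
Proof. by elim: t => //= t <-; case: (trace O w t) => z [q [[l h] r]]. Qed.

(** The head moves by at most one cell per step. Starting at [O >= t] keeps the truncated
    predecessor in [pstep] exact. *)
Lemma trace_bounds O w t : t <= O -> let: (z, (q, (l, h, r))) := trace O w t in
  [/\ O + size l <= z + t, z <= O + t & z + size r <= O + size w + t].
Proof.
elim: t => [|t IH] lt.
  by rewrite /trace /=; case: w => [|b w] /=; rewrite ?size_map; split; lia.
move: (IH (ltnW lt)); rewrite /trace /=; case: (iter t _ _) => z [q [[l h] r]] [h1 h2 h3] /=.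
case: ifP => _; first by split; lia.
case: (tm_delta N q h) => [[q' w'] []] /=.
- by case: l h1 => [|a l] /= h1; split; lia.
- by case: r h3 => [|a r] /= h3; split; lia.
- by split; lia.
Qed.
End Tableau.

(** * The tableau of a verifier *)

Section Verifier.
Variables (N : TM) (c1 k1 c2 k2 : nat).
Implicit Types x y : str.

Definition wbound x := poly_bound c1 k1 (size x).
Definition sbound x := 2 * size x + 2 + wbound x.
(** Larger than the time bound and the length of the words considered, so that from [origin] the
    head reaches neither column 0 nor the column behind the last one; both stay blank. *)
Definition tbound x := poly_bound c2 k2 (sbound x) + sbound x + 1.
Definition origin x := tbound x + 1.
Definition width x := 3 * tbound x + 3.
Definition ncells x := width x * (tbound x + 1).

(* Cell [(t, p)] of the tableau, for [t <= tbound x] and [p < width x], has number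
   [t * width x + p]. Its left neighbour is taken on a helical torus; this is
   harmless because the first column is forced to be blank. *)
Definition shift x (i : bool) : nat := if i then ncells x - width x else ncells x - 1.

Notation cellN := (cell N).
(* Left neighbour, cell, right neighbour, and the same cell one step later. *)
Definition tile : finType := (cellN * cellN * cellN * cellN)%type.
Definition color : finType := (cellN * cellN)%type.

Definition lcol (i : bool) (d : tile) : color :=
  let: (a, c, b, n) := d in if i then (c, c) else (a, c).
Definition rcol (i : bool) (d : tile) : color :=
  let: (a, c, b, n) := d in if i then (n, n) else (c, b).

(** Only the cell with the head is constrained, since the output begins at the head. *)
Definition final_ok (c : cellN) : bool := (c.1 == None) || (c.2 == Some true).

(** [q] counts from the origin: the doubled bits of [x], the separator, and the certificate, which
    is free except that no symbol follows a blank. *)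
Definition init_symbol_ok x (q : nat) (a c : cellN) : bool :=
  if q < 2 * size x then
    if c.2 is Some b then b == nth false x (q %/ 2) else false
  else if q == 2 * size x then c.2 == Some false
  else if q == 2 * size x + 1 then c.2 == Some true
  else if q < sbound x then
    (2 * size x + 2 < q) ==> (a.2 == None) ==> (c.2 == None)
  else c.2 == None.

Definition init_ok x (v : nat) (a c : cellN) : bool :=
  (if v == origin x then c.1 == Some (tm_start N) else c.1 == None) &&
  (if v < origin x then c.2 == None else init_symbol_ok x (v - origin x) a c).

(** In column 0, whose left neighbour on the torus belongs to another row, a blank replaces the
    transition rule. *)
Definition tile_ok x (v : nat) (d : tile) : bool :=
  let: (a, c, b, n) := d in
  [&& (v + width x < ncells x) ==>
        (if v %% width x == 0 then n == blank N else n == next_cell a c b),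
      (ncells x <= v + width x) ==> final_ok c &
      (v < width x) ==> init_ok x v a c].

Lemma FN_wbound fx : FP fx -> FN (fun e => wbound (fx e)).
Proof. by move=> Fx; apply: FN_poly_bound; apply: FN_size. Qed.

Lemma FN_sbound fx : FP fx -> FN (fun e => sbound (fx e)).
Proof.
move=> Fx; apply: FN_add (FN_wbound Fx); apply: FN_add (FN_cst 2).
exact: FN_mul (FN_cst 2) (FN_size Fx).
Qed.

Lemma FN_tbound fx : FP fx -> FN (fun e => tbound (fx e)).
Proof.
move=> Fx; apply: FN_add (FN_cst 1); apply: FN_add (FN_sbound Fx).
exact: FN_poly_bound (FN_sbound Fx).
Qed.

Lemma FN_origin fx : FP fx -> FN (fun e => origin (fx e)).
Proof. by move=> Fx; apply: FN_add (FN_tbound Fx) (FN_cst 1). Qed.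

Lemma FN_width fx : FP fx -> FN (fun e => width (fx e)).
Proof.
by move=> Fx; apply: FN_add (FN_cst 3); exact: FN_mul (FN_cst 3) (FN_tbound Fx).
Qed.

Lemma FN_ncells fx : FP fx -> FN (fun e => ncells (fx e)).
Proof.
by move=> Fx; apply: FN_mul (FN_width Fx) _; exact: FN_add (FN_tbound Fx) (FN_cst 1).
Qed.

Lemma FN_shift fx i : FP fx -> FN (fun e => shift (fx e) i).
Proof.
move=> Fx; case: i; apply: FN_sub (FN_ncells Fx) _; [exact: FN_width|exact: FN_cst].
Qed.

Lemma FB_tile_ok fx fv (d : tile) : FP fx -> FN fv -> FB (fun e => tile_ok (fx e) (fv e) d).
Proof.
case: d => [[[a c] b] n] Fx Fv; rewrite /tile_ok.
have Fw := FN_width Fx; have Fn := FN_ncells Fx; have Fo := FN_origin Fx.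
have Fvw := FN_add Fv Fw.
apply: FB_and; last apply: FB_and.
- apply: FB_imply; first exact: FB_ltn.
  apply: FB_if; [|exact: FB_cst..].
  by apply: FB_eqn (FN_cst 0); exact: FN_mod.
- by apply: FB_imply; [exact: FB_leq|exact: FB_cst].
- apply: FB_imply; first exact: FB_ltn.
  apply: FB_and; first by apply: FB_if; [exact: FB_eqn|exact: FB_cst..].
  apply: FB_if; [exact: FB_ltn|exact: FB_cst|].
  have Fq := FN_sub Fv Fo; have F2 := FN_mul (FN_cst 2) (FN_size Fx).
  rewrite /init_symbol_ok; apply: FB_if; first exact: FB_ltn.
    case: c.2 => [s|]; last exact: FB_cst.
    have Fb : FB (fun e => nth false (fx e) ((fv e - origin (fx e)) %/ 2)).
      by apply: FB_nth => //; exact: FN_div Fq (FN_cst 2).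
    by case: s; [apply: FB_ext Fb _|apply: FB_ext (FB_not Fb) _] => e; case: (nth _ _ _).
  apply: FB_if; [exact: FB_eqn|exact: FB_cst|].
  apply: FB_if; [by apply: FB_eqn => //; exact: FN_add F2 (FN_cst 1)|exact: FB_cst|].
  apply: FB_if; [by apply: FB_ltn => //; exact: FN_sbound| |exact: FB_cst].
  by apply: FB_imply; [apply: FB_ltn => //; exact: FN_add F2 (FN_cst 2)|exact: FB_cst].
Qed.

Lemma width_gt0 x : 0 < width x.
Proof. by rewrite /width addn_gt0 orbT. Qed.

Lemma tbound_gt0 x : 0 < tbound x.
Proof. by rewrite /tbound addn1. Qed.

Lemma ncells_gt0 x : 0 < ncells x.
Proof. by rewrite muln_gt0 width_gt0 addn1. Qed.

Lemma width_lt_ncells x : width x < ncells x.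
Proof. by rewrite /ncells addn1 mulnS -[X in X < _]addn0 ltn_add2l muln_gt0 width_gt0 tbound_gt0. Qed.

Lemma shift_le x i : shift x i <= ncells x.
Proof. by case: i; apply: leq_subr. Qed.

Lemma nb_left x v : 0 < v -> v < ncells x -> nb (ncells x) (shift x) false v = v.-1.
Proof.
move=> v0 vV; rewrite /nb /shift.
have -> : v + (ncells x - 1) = v.-1 + ncells x by lia.
by rewrite modnDr modn_small //; lia.
Qed.

Lemma nb_below x v : v + width x < ncells x ->
  nb (ncells x) (shift x) true (v + width x) = v.
Proof.
move=> vV; rewrite /nb /shift; have WV := ltnW (width_lt_ncells x).
by rewrite -addnA subnKC // modnDr modn_small //; lia.
Qed.

Lemma size_double x : size (flatten [seq [:: b; b] | b <- x]) = 2 * size x.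
Proof. by elim: x => //= b x ->; rewrite mulnS. Qed.

Lemma size_pair_enc x y : size (pair_enc x y) = 2 * size x + 2 + size y.
Proof. by rewrite /pair_enc size_cat size_double -addnA. Qed.

Lemma nth_double x q : nth false (flatten [seq [:: b; b] | b <- x]) q = nth false x (q %/ 2).
Proof.
elim: x q => [|b x IH] [|[|q]] //=; first by rewrite !nth_nil.
have -> : q.+2 %/ 2 = (q %/ 2).+1 by rewrite -addn2 divnDr // addn1.
exact: IH.
Qed.

Lemma nth_pair_enc x y q : nth None (map Some (pair_enc x y)) q =
  if q < 2 * size x then Some (nth false x (q %/ 2))
  else if q == 2 * size x then Some false
  else if q == 2 * size x + 1 then Some true
  else nth None (map Some y) (q - (2 * size x + 2)).
Proof.
rewrite /pair_enc map_cat nth_cat size_map size_double; case: ltnP => le.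
  by rewrite (nth_map false) ?size_double // nth_double.
have [-> | [-> | lt]] : q = 2 * size x \/ q = 2 * size x + 1 \/ 2 * size x + 1 < q by lia.
- by rewrite subnn eqxx.
- by rewrite addKn eqxx ifF //; lia.
rewrite !ifF; [|by lia..].
by have -> : q - 2 * size x = (q - (2 * size x + 2)).+2 by lia.
Qed.

(** * From accepted certificates to tableaux *)

Section Complete.
Variables (x y : str).
Hypotheses (ysz : size y <= wbound x).
Let w := pair_enc x y.
Let tr := trace N (origin x) w.
Let cont t p := contents (tr t) p.

Lemma size_w : size w <= sbound x.
Proof. by rewrite /w size_pair_enc leq_add2l. Qed.

Lemma trace_facts t : t <= tbound x ->
  [/\ 0 < (tr t).1, (tr t).1 < width x, cont t 0 = blank N & cont t (width x) = blank N].
Proof.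
move=> tT; have := @trace_bounds N (origin x) w t; rewrite -/(tr t) /cont.
have sw := size_w; have sT : sbound x <= tbound x by rewrite /tbound; lia.
case: (tr t) => z [q [[l h] r]] /= []; first by rewrite /origin; lia.
rewrite /origin => h1 h2 h3; have hw : width x = 3 * tbound x + 3 by [].
split; [by lia|by lia|..].
- rewrite /blank /symbol ifF ?ifT ?subn0; [|by lia|by lia].
  by rewrite nth_default //; lia.
- rewrite /blank /symbol !ifF; [|by lia|by lia].
  by rewrite nth_default //=; lia.
Qed.

Lemma cont_succ t p : t < tbound x -> 0 < p ->
  cont t.+1 p = next_cell (cont t p.-1) (cont t p) (cont t p.+1).
Proof.
by move=> tT p0; have [z0 _ _ _] := trace_facts (ltnW tT); rewrite -contents_step.
Qed.

Lemma cont0 p : cont 0 p = (if p == origin x then Some (tm_start N) else None,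
  if p < origin x then None else nth None (map Some w) (p - origin x)).
Proof.
rewrite /cont /tr /trace /= /tm_init; case: w => [|b v] /=.
  by rewrite /symbol /= !nth_nil; case: ltnP => // _; case: (p - origin x) => // -[].
by rewrite /symbol /= nth_nil.
Qed.

Lemma cont_init p : init_ok x p (cont 0 p.-1) (cont 0 p).
Proof.
rewrite /init_ok !cont0 /=; apply/andP; split; first by case: eqP.
case: ltnP => pO //; rewrite /init_symbol_ok /= nth_pair_enc.
set q := p - origin x.
case: ltnP => q1; first exact: eqxx.
case: (q =P 2 * size x) => q2 //; case: (q =P 2 * size x + 1) => q3 //.
case: ltnP => q4; last by rewrite nth_default ?size_map //; move: q4; rewrite /sbound; lia.
apply/implyP => q5; rewrite ifF; last by lia.
have -> : p.-1 - origin x = q.-1 by rewrite /q; lia.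
rewrite nth_pair_enc !ifF; [|by lia..].
have -> : q - (2 * size x + 2) = (q.-1 - (2 * size x + 2)).+1 by lia.
set j := _ - _; apply/implyP; case: (ltnP j (size y)) => lt; first by rewrite (nth_map false).
by move=> _; rewrite nth_default // size_map leqW.
Qed.

Definition cellval (v : nat) : cellN := cont (v %/ width x) (v %% width x).

Lemma cellvalE t p : p < width x -> cellval (t * width x + p) = cont t p.
Proof.
by move=> pW; rewrite /cellval divnMDl ?width_gt0 // modnMDl divn_small // modn_small // addn0.
Qed.

Definition tableau (v : nat) : tile :=
  (cellval (nb (ncells x) (shift x) false v), cellval v,
   cellval (v.+1 %% ncells x), cellval ((v + width x) %% ncells x)).

Lemma tableau_csp : final_ok (cont (tbound x) (tr (tbound x)).1) ->
  csp_sol (ncells x) (shift x) (tile_ok x) lcol rcol tableau.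
Proof.
move=> fin v vV; split; last first.
  have WV := ltnW (width_lt_ncells x).
  case; rewrite /tableau /= /nb /shift.
    by rewrite modnDml -addnA subnK // modnDr modn_small.
  rewrite -[(_ %% _).+1]addn1 modnDml -addnA subnK ?ncells_gt0 //.
  by rewrite modnDr [v %% _]modn_small.
have W0 := width_gt0 x; have V0 := ncells_gt0 x; have WV := width_lt_ncells x.
set t := v %/ width x; set p := v %% width x.
have pW : p < width x by rewrite ltn_pmod.
have vE : v = t * width x + p by apply: divn_eq.
have tT : t <= tbound x.
  by rewrite -ltnS -[X in _ < X]addn1 ltn_divLR // mulnC.
have cv : cellval v = cont t p by [].
rewrite /tile_ok /tableau cv; apply/and3P; split.
- apply/implyP => vW; have {}tT : t < tbound x.
    have : t.+1 * width x < ncells x by rewrite mulSn addnC; lia.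
    by rewrite /ncells mulnC ltn_pmul2l // addn1.
  have up : cellval ((v + width x) %% ncells x) = cont t.+1 p.
    by rewrite modn_small // {1}vE addnAC -mulSnr cellvalE.
  rewrite up -/p; case: eqP => p0; first by rewrite p0; have [_ _ -> _] := trace_facts tT.
  rewrite cont_succ //; last by lia.
  rewrite nb_left //; last by lia.
  have -> : cellval v.-1 = cont t p.-1.
    have -> : v.-1 = t * width x + p.-1 by lia.
    by rewrite cellvalE //; lia.
  suff -> : cellval (v.+1 %% ncells x) = cont t p.+1 by [].
  rewrite modn_small; last by lia.
  have [pS|pS] : p.+1 < width x \/ p.+1 = width x by lia.
    have -> : v.+1 = t * width x + p.+1 by lia.
    by rewrite cellvalE.
  (* The right neighbour of the last column is column 0 of the next row, which is blank like the
     column behind the last one. *)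
  have -> : v.+1 = t.+1 * width x + 0 by rewrite mulSn; lia.
  rewrite cellvalE // pS.
  by have [_ _ -> _] := trace_facts tT; have [_ _ _ ->] := trace_facts (ltnW tT).
- apply/implyP => vW; have {}tT : t = tbound x.
    apply/eqP; rewrite eqn_leq tT /=.
    have : tbound x * width x < t.+1 * width x.
      have : ncells x = tbound x * width x + width x by rewrite /ncells addn1 mulnC mulSnr.
      by rewrite mulSn; lia.
    by rewrite ltn_pmul2r.
  rewrite tT; move: fin; rewrite /final_ok /cont; case: (tr _) => z [q [[l h] r]] /=.
  by case: (p =P z) => [->|//]; rewrite eqxx.
- apply/implyP => vW; have t0 : t = 0 by rewrite /t divn_small.
  have pv : p = v by rewrite /p modn_small.
  rewrite t0 pv; have [v0|v0] := posnP v; last first.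
    rewrite nb_left //.
    have -> : cellval v.-1 = cont 0 v.-1.
      by have := @cellvalE 0 v.-1; rewrite mul0n add0n; apply; lia.
    exact: cont_init.
  (* The left neighbour of cell 0 is the last cell of the tableau, but left of the origin [init_ok]
     does not look at it. *)
  have := cont_init 0; rewrite v0 /init_ok /= /origin.
  by case: ifP => // _; rewrite ifT // addn1.
Qed.

End Complete.

(** * From tableaux to accepted certificates *)

Lemma read_out_nth (s : seq (option bool)) j :
  (forall i, i.+1 < size s -> nth None s i = None -> nth None s i.+1 = None) ->
  nth None (map Some (read_out s)) j = nth None s j.
Proof.
elim: s j => [|[b|] s IH] j hs //=.
  case: j => //= j; apply: IH => i lt; exact: (hs i.+1).
case: j => //= j.
have : forall i, i < size s -> nth None s i = None.
  elim=> [|i IHi] lt; first exact: (hs 0).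
  by apply: (hs i.+1) => //=; apply: IHi; apply: ltnW.
by move=> hs'; case: (ltnP j (size s)) => lt; [rewrite hs'|rewrite nth_default].
Qed.

Lemma read_out_size (s : seq (option bool)) : size (read_out s) <= size s.
Proof. by elim: s => [|[b|] s IH]. Qed.

(** The certificate is read off the first row behind the separator. By induction on the rows, the
    second components of the tiles are the cells of the run on it. *)
Lemma csp_trace x f : csp_sol (ncells x) (shift x) (tile_ok x) lcol rcol f ->
  exists2 y, size y <= wbound x &
    let tr := trace N (origin x) (pair_enc x y) in
    final_ok (contents (tr (tbound x)) (tr (tbound x)).1).
Proof.
move=> fP; have W0 := width_gt0 x; have V0 := ncells_gt0 x; have WV := width_lt_ncells x.
pose c v := (f v).1.1.2.
pose s := [seq (c (origin x + (2 * size x + 2) + j)).2 | j <- iota 0 (wbound x)].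
pose y := read_out s.
have sz : size s = wbound x by rewrite size_map size_iota.
have ysz : size y <= wbound x by rewrite -sz read_out_size.
exists y => //=; pose cont t p := contents (trace N (origin x) (pair_enc x y) t) p.
have left v : 0 < v -> v < ncells x -> (f v).1.1.1 = c v.-1 /\ c v = (f v.-1).1.2.
  move=> v0 vV; have [_ /(_ false)] := fP v vV; rewrite nb_left // /c.
  by case: (f v) => [[[a1 a2] a3] a4]; case: (f v.-1) => [[[b1 b2] b3] b4] /= [-> ->].
have below v : v + width x < ncells x -> c (v + width x) = (f v).2.
  move=> vV; have [_ /(_ true)] := fP _ vV; rewrite nb_below // /c.
  by case: (f _) => [[[a1 a2] a3] a4]; case: (f v) => [[[b1 b2] b3] b4] /= [->].
have inW q : q < sbound x -> origin x + q < width x.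
  by rewrite /origin /width /tbound; lia.
have init v : v < width x -> init_ok x v (f v).1.1.1 (c v).
  move=> vW; have [+ _] := fP v (ltn_trans vW WV).
  by rewrite /tile_ok /c vW; case: (f v) => [[[a1 a2] a3] a4] /= /and3P[].
(* No symbol follows a blank in the certificate zone, so that [read_out] loses nothing. *)
have sE j : nth None (map Some y) j = nth None s j.
  apply: read_out_nth => i; rewrite sz => lt.
  rewrite !(nth_map 0) ?size_iota ?nth_iota ?add0n //; try lia.
  set v := origin x + (2 * size x + 2) + i.
  have e1 : origin x + (2 * size x + 2) + i.+1 = v.+1 by rewrite addnS.
  rewrite e1 => ci.
  have vW : v.+1 < width x by rewrite -e1 -addnA inW // /sbound; lia.
  have := init v.+1 vW; rewrite /init_ok => /andP[_].
  rewrite ifF; last by rewrite /v; lia.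
  have -> : v.+1 - origin x = 2 * size x + 2 + i.+1 by rewrite /v; lia.
  rewrite /init_symbol_ok 3?ifF; [|by lia..].
  rewrite ifT; last by rewrite /sbound; lia.
  have [-> _] := left v.+1 isT (ltn_trans vW WV).
  have -> : 2 * size x + 2 < 2 * size x + 2 + i.+1 by lia.
  by rewrite ci eqxx => /eqP.
have row0 p : p < width x -> c p = cont 0 p.
  move=> pW; rewrite /cont cont0; have := init p pW; rewrite /init_ok.
  case cp : (c p) => [u1 u2] /= /andP[h1 h2]; congr (_, _); first by case: eqP h1 => _ /eqP.
  case: (ltnP p (origin x)) h2 => pO; first by move/eqP.
  rewrite nth_pair_enc /init_symbol_ok /=; have pq : p = origin x + (p - origin x) by lia.
  move: (p - origin x) pq => q pq.
  case: (ltnP q (2 * size x)) => q1; first by case: (u2) => // b /eqP ->.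
  case: (q =P 2 * size x) => q2; first by move/eqP.
  case: (q =P 2 * size x + 1) => q3; first by move/eqP.
  rewrite sE; case: (ltnP q (sbound x)) => q4; last first.
    by move/eqP ->; rewrite nth_default // sz; move: q4; rewrite /sbound; lia.
  move=> _; rewrite (nth_map 0) ?size_iota ?nth_iota; [|by move: q4; rewrite /sbound; lia..].
  have -> : origin x + (2 * size x + 2) + (0 + (q - (2 * size x + 2))) = p by lia.
  by rewrite cp.
have rows t : t <= tbound x -> forall p, p < width x -> c (t * width x + p) = cont t p.
  elim: t => [_ p pW|t IH tT p pW]; first by rewrite mul0n add0n row0.
  have nx q : q < width x -> t * width x + q + width x < ncells x.
    move=> qW; have : (t.+2) * width x <= ncells x.
      by rewrite /ncells addn1 mulnC leq_mul2l ltnS tT orbT.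
    by rewrite !mulSn; lia.
  have stepE q : q < width x -> c (t.+1 * width x + q) =
      if q == 0 then blank N else next_cell (f (t * width x + q)).1.1.1
        (c (t * width x + q)) (f (t * width x + q)).1.2.
    move=> qW; have -> : t.+1 * width x + q = t * width x + q + width x by rewrite mulSn; lia.
    rewrite below ?nx //; have [|+ _] := fP (t * width x + q); first by have := nx q qW; lia.
    rewrite /tile_ok /c; have := nx q qW; case: (f _) => [[[a1 a2] a3] a4] /= nxq.
    case/and3P => + _ _; rewrite nxq modnMDl modn_small //=.
    by case: ifP => _ /eqP.
  have [_ _ bl0 _] := trace_facts ysz tT.
  have [_ _ bl1 blW] := trace_facts ysz (ltnW tT).
  rewrite stepE //; case: eqP => p0; first by rewrite p0 /cont bl0.
  rewrite [RHS](cont_succ ysz tT); last by lia.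
  have vV : t * width x + p < ncells x by have := nx p pW; lia.
  have [-> _] := left (t * width x + p) (ltac:(lia)) vV.
  rewrite -[(f _).1.2](left (t * width x + p).+1 isT _).2; last by have := nx p pW; lia.
  have -> : (t * width x + p).-1 = t * width x + p.-1 by lia.
  rewrite !IH ?(ltnW tT) //; last by lia.
  have [pS|pS] : p.+1 < width x \/ p.+1 = width x by lia.
    have -> : (t * width x + p).+1 = t * width x + p.+1 by lia.
    by rewrite IH // ltnW.
  have -> : (t * width x + p).+1 = t.+1 * width x + 0 by rewrite mulSn; lia.
  by rewrite stepE //= pS /cont blW.
have [z0 zW _ _] := trace_facts ysz (leqnn _); set z := (trace _ _ _ _).1 in z0 zW *.
rewrite -[contents _ _]/(cont (tbound x) z) -rows //.
have nE : ncells x = tbound x * width x + width x by rewrite /ncells addn1 mulnC mulSnr.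
set v := _ + _; have vV : v < ncells x by rewrite /v nE; lia.
have [+ _] := fP v vV; rewrite /tile_ok /c; case: (f v) => [[[a1 a2] a3] a4] /= /and3P[_ + _].
by move/implyP; apply; rewrite /v nE; lia.
Qed.

Lemma csp_accepts (L : str -> Prop) :
  (forall w, exists t b, [/\ t <= poly_bound c2 k2 (size w),
     runs N w t [:: b] & (b = true <-> L w)]) ->
  forall x, (exists f, csp_sol (ncells x) (shift x) (tile_ok x) lcol rcol f) <->
    exists y, size y <= wbound x /\ L (pair_enc x y).
Proof.
move=> dec x.
(* The verifier has halted by time [tbound x], and its output, a single bit read from the head on,
   is the symbol under the head. *)
have fin y : size y <= wbound x ->
    let d := trace N (origin x) (pair_enc x y) (tbound x) in
    final_ok (contents d d.1) <-> L (pair_enc x y).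
  move=> ysz /=; have [t [b [tb run <-]]] := dec (pair_enc x y).
  have tT : t <= tbound x.
    apply: leq_trans tb _; rewrite /tbound -addnA; apply: leq_trans (leq_addr _ _).
    apply: poly_bound_mono; rewrite size_pair_enc leq_add2l //.
  have := runs_output run tT; rewrite -(trace_config N (origin x)).
  case: (trace _ _ _ _) => z [q [[l h] r]] /=; rewrite /final_ok /= eqxx /symbol ltnn subnn /=.
  by case: h => // a [->]; case: b {run}.
split=> [[f /csp_trace[y ysz /(fin y ysz)]]|[y [ysz Ly]]]; first by exists y.
by exists (tableau x y); apply: tableau_csp => //; apply/(fin y ysz).
Qed.
End Verifier.

Local Open Scope ring_scope.

Theorem theorem5 (alpha : nat -> nat -> nat) (R : realType) (r : R) :
  normal_DPSF alpha -> poly_bounded_DPSF alpha ->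
  0 < r -> r <= 1 ->
  ~ P_eq_NP ->
  ~ (exists M : TM, approx_algorithm alpha R r M).
Proof.
move=> normal [ca [ka pbd]] r0 _ PNP [M apx]; apply: PNP => L [VL [[N [c2 [k2 decV]]] [c1 [k1 LV]]]].
pose V x := ncells c1 k1 c2 k2 x.
(* By the Archimedean property some natural number is at least [1 / r]. *)
have [rho rhoP] : exists rho : nat, 1 <= r * rho%:R.
  exists (Num.bound r^-1); rewrite -[leLHS](mulfV (lt0r_neq0 r0)) ler_pM2l // ltW //.
  by apply: archi_boundP; rewrite invr_ge0 ltW.
(* Apart from constants only [V x] enters, so that [mp] can be computed in unary in polynomial
   time. *)
pose mp x := (rho * poly_bound ca ka (nalt1 (tile N) (V x)) + 1)%N.
have FV fx : FP fx -> FN (fun e => V (fx e)) by exact: (FN_ncells c1 k1 c2 k2).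
have Fmp fx : FP fx -> FN (fun e => mp (fx e)).
  move=> Fx; apply: FN_add (FN_cst 1); apply: FN_mul (FN_cst _) _; apply: FN_poly_bound.
  by apply: FN_mul (FV _ Fx) (FN_cst _).
have [dec Fdec decP] := gap_decides ((blank N, blank N, blank N, blank N) : tile N) (@lcol N) (@rcol N)
  (ncells_gt0 c1 k1 c2 k2) (shift_le c1 k1 c2 k2) FV Fmp
  (fun fx i Fx => FN_shift c1 k1 c2 k2 i Fx)
  (fun fx fv d Fx Fv => FB_tile_ok c1 k1 c2 k2 d Fx Fv)
  normal apx r0 pbd rhoP (fun x => erefl).
have [D [c [k runD]]] := FP_runs Fdec.
exists D, c, k => x; have [t tb run] := runD x; exists t, (dec x); split=> //.
rewrite LV -(csp_accepts c1 k1 decV); exact: decP.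
Qed.
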